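(* Let $n\ge 4$ and let $F_n^2$ be the complex $n$-dimensional Leibniz algebra with basis $\{x_1,\dots,x_n\}$ and multiplication $[x_i,x_1]=x_{i+1}$ for $1\le i\le n-2$ (all other products of basis elements are zero). Let $W\subset ZL^2(F_n^2,F_n^2)$ be the linear span of the cocycles $\varphi_{n,n}$, $\varphi_{n-1,k}$ ($2\le k\le n$) and $\psi_k$ ($1\le k\le n+2$) (a space of representatives of $HL^2(F_n^2,F_n^2)$). Then for every linear integrable deformation $\varphi\in W$ the Leibniz algebra $F_n^2+\varphi$ admits a basis $\{x_1,\dots,x_n\}$ in which its table of multiplication has one of the following forms (all parameters are complex numbers, all products not listed are zero): - the family $F_1$: $[x_i,x_1]=x_{i+1}$ ($2\le i\le n-1$), $[x_1,x_2]=\theta x_n$, $[x_j,x_2]=\alpha_4x_{j+2}+\alpha_5x_{j+3}+\dots+\alpha_{n+2-j}x_n$ ($2\le j\le n-2$); - the family $F_2$: $[x_i,x_1]=x_{i+1}$ ($1\le i\le n-2$), $[x_j,x_n]=\beta_3x_{j+2}+\beta_4x_{j+3}+\dots+\beta_{n-j}x_{n-1}$ ($1\le j\le n-3$), $[x_n,x_n]=\gamma x_{n-1}$; - $\widetilde\mu(a_2,\dots,a_n)$: $[x_i,x_1]=x_{i+1}$ ($1\le i\le n-1$), $[x_n,x_1]=\sum_{k=2}^n a_kx_k$; - $\widetilde\mu(a_2,\dots,a_{n-1})\oplus\mathbb{C}$, the direct sum of the $(n-1)$-dimensional algebra $[x_i,x_1]=x_{i+1}$ ($1\le i\le n-2$),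 $[x_{n-1},x_1]=\sum_{k=2}^{n-1}a_kx_k$, and the one-dimensional abelian algebra; - $\nu_1(a_2,\dots,a_{n-1})$: $[x_i,x_1]=x_{i+1}$ ($1\le i\le n-2$), $[x_{n-1},x_1]=\sum_{k=2}^{n-1}a_kx_k$ with $\sum_{k=2}^{n-1}a_k=1$, $[x_n,x_1]=x_n$; - $\nu_2$: $[x_i,x_1]=x_{i+1}$ ($1\le i\le n-2$), $[x_n,x_1]=x_1$, $[x_i,x_n]=-i\,x_i$ ($1\le i\le n-1$); - $\nu_3(b_2,\dots,b_{n-1})$: $[x_i,x_1]=x_{i+1}$ ($1\le i\le n-2$), $[x_{n-1},x_1]=-x_{n-1}$, $[x_n,x_1]=-x_n$, $[x_1,x_n]=x_n+\sum_{k=2}^{n-1}b_kx_k$, $[x_i,x_n]=\sum_{k=2}^{n-i}b_kx_{k+i-1}$ ($2\le i\le n-2$), where the first non-zero element of the vector $(b_2,\dots,b_{n-1})$ can be assumed to be equal to $1$; - $\nu_4$: $[x_i,x_1]=x_{i+1}$ ($1\le i\le n-2$), $[x_{n-1},x_1]=-2x_{n-1}$, $[x_n,x_1]=-x_n$, $[x_1,x_n]=x_n$, $[x_n,x_n]=x_{n-1}$; - $\nu_5(a_2,\dots,a_{n-1})$: $[x_i,x_1]=x_{i+1}$ ($1\le i\le n-2$), $[x_{n-1},x_1]=\sum_{k=2}^{n-1}a_kx_k$, $[x_n,x_1]=-x_n$, $[x_1,x_n]=x_n$.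
   Context: A Leibniz algebra over $\mathbb{C}$ is a vector space $L$ with a bilinear bracket satisfying $[x,[y,z]]=[[x,y],z]-[[x,z],y]$. $ZL^2(L,L)$ is the space of $2$-cocycles: bilinear maps $\varphi:L\times L\to L$ with $[x,\varphi(y,z)]-[\varphi(x,y),z]+[\varphi(x,z),y]+\varphi(x,[y,z])-\varphi([x,y],z)+\varphi([x,z],y)=0$ for all $x,y,z$; $HL^2(L,L)$ is its quotient by the coboundaries $f(x,y)=[d(x),y]+[x,d(y)]-d([x,y])$, $d:L\to L$ linear. A $2$-cocycle $\varphi$ is a linear integrable deformation if $\varphi(x,\varphi(y,z))-\varphi(\varphi(x,y),z)+\varphi(\varphi(x,z),y)=0$ for all $x,y,z$; equivalently, for a cocycle $\varphi$, the bracket $[-,-]+t\varphi$ is a Leibniz bracket for all $t$ (equivalently for $t=1$). $F_n^2+\varphi$ denotes the vector space of $F_n^2$ with bracket $[x,y]+\varphi(x,y)$. The cocycles of $F_n^2$ used here are the bilinear maps with the following nonzero values on pairs of basis elements (all values not listed are zero): $\varphi_{j,k}(x_j,x_1)=x_k$ for $1\le j\le n$, $2\le k\le n$; $\psi_1(x_n,x_1)=x_1$, $\psi_1(x_i,x_n)=-i\,x_i$ for $1\le i\le n-1$; for $2\le j\le n-1$, $\psi_j(x_i,x_n)=x_{j+i-1}$ for $1\le i\le n-j$; $\psi_n(x_1,x_n)=x_n$; $\psi_{n+1}(x_n,x_n)=x_{n-1}$; $\psi_{n+2}(x_n,x_n)=x_n$. *)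

(* Defs.v *)
From mathcomp Require Import all_boot all_order all_algebra.
From mathcomp Require Import reals complex.

Set Implicit Arguments.
Unset Strict Implicit.
Unset Printing Implicit Defensive.

Import GRing.Theory.
Local Open Scope ring_scope.

Definition bilinear_map (K : fieldType) (V : lmodType K) (f : V -> V -> V) :
  Prop := bilinear_for *:%R *:%R f.

Lemma bilinear_mapDl (K : fieldType) (V : lmodType K) (f : V -> V -> V) :
  bilinear_map f -> forall u v w, f (u + v) w = f u w + f v w.
Proof. by case=> fl _ u v w; have := fl w 1 u v; rewrite /= !scale1r. Qed.

Lemma bilinear_mapDr (K : fieldType) (V : lmodType K) (f : V -> V -> V) :
  bilinear_map f -> forall u v w, f u (v + w) = f u v + f u w.
Proof. by case=> _ fr u v w; have := fr u 1 v w; rewrite /= !scale1r. Qed.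

Lemma bilinear_mapD (K : fieldType) (V : lmodType K) (f g : V -> V -> V) :
  bilinear_map f -> bilinear_map g -> bilinear_map (fun u v => f u v + g u v).
Proof.
move=> [fl fr] [gl gr]; split=> w a u v /=.
  by have /= -> := fl w a u v; have /= -> := gl w a u v; rewrite scalerDr addrACA.
by have /= -> := fr w a u v; have /= -> := gr w a u v; rewrite scalerDr addrACA.
Qed.

Record leibnizAlg (K : fieldType) (V : lmodType K) := LeibnizAlg {
  lbracket :> V -> V -> V;
  lbracket_bilinear : bilinear_map lbracket;
  lbracket_leibniz : forall x y z : V,
    lbracket x (lbracket y z) =
    lbracket (lbracket x y) z - lbracket (lbracket x z) y
}.

(* Membership in ZL^2(L, L). *)
Definition cocycle2 (K : fieldType) (V : lmodType K) (L : leibnizAlg V)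
    (phi : V -> V -> V) : Prop :=
  bilinear_map phi /\
  forall x y z : V,
    L x (phi y z) - L (phi x y) z + L (phi x z) y
    + phi x (L y z) - phi (L x y) z + phi (L x z) y = 0.

Definition linear_integrable_deformation (K : fieldType) (V : lmodType K)
    (L : leibnizAlg V) (phi : V -> V -> V) : Prop :=
  cocycle2 L phi /\
  forall x y z : V, phi x (phi y z) - phi (phi x y) z + phi (phi x z) y = 0.

Lemma deformation_leibniz (K : fieldType) (V : lmodType K) (L : leibnizAlg V)
    (phi : V -> V -> V) (phiP : linear_integrable_deformation L phi)
    (mu := fun u v => L u v + phi u v) (x y z : V) :
  mu x (mu y z) = mu (mu x y) z - mu (mu x z) y.
Proof.
have [[pbil pcoc] pint] := phiP; have Lbil := lbracket_bilinear L.
rewrite /mu !(bilinear_mapDl Lbil, bilinear_mapDr Lbil).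
rewrite !(bilinear_mapDl pbil, bilinear_mapDr pbil) lbracket_leibniz.
have -> : phi x (phi y z) = phi (phi x y) z - phi (phi x z) y.
  by apply/eqP; rewrite -subr_eq0 opprB addrA addrAC; apply/eqP.
have Ecoc : L x (phi y z) + phi x (L y z) =
    (L (phi x y) z - L (phi x z) y) + (phi (L x y) z - phi (L x z) y).
  apply/eqP; rewrite -subr_eq0 -(pcoc x y z) !opprD !opprK !addrA; apply/eqP.
  by rewrite (ACl (1*3*4*2*5*6)).
rewrite !addrA -(addrA (_ - _) (L x _)) Ecoc !opprD !addrA.
by rewrite [LHS](ACl (1*3*5*7*2*4*6*8)).
Qed.

(* L + phi *)
Definition deformation (K : fieldType) (V : lmodType K) (L : leibnizAlg V)
    (phi : V -> V -> V) (phiP : linear_integrable_deformation L phi) :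
    leibnizAlg V :=
  LeibnizAlg (bilinear_mapD (lbracket_bilinear L) phiP.1.1)
    (deformation_leibniz phiP).

(* Basis vectors are indexed by natural numbers from 1 to n.  A multiplication *)
(* table on a basis x sends (i, j) to the product of x i and x j; only the     *)
(* values at 1 <= i, j <= n are meaningful.                                    *)
Definition mtable (K : fieldType) : Type :=
  forall V : lmodType K, (nat -> V) -> nat -> nat -> V.

Definition has_mtable (K : fieldType) (V : vectType K) (n : nat)
    (L : leibnizAlg V) (T : mtable K) : Prop :=
  exists2 X : n.-tuple V, basis_of fullv X &
    let x k := X`_k.-1 in
    forall i j, (1 <= i <= n)%N -> (1 <= j <= n)%N -> L (x i) (x j) = T V x i j.

Definition std_basis (K : fieldType) (n k : nat) : 'rV[K]_n :=
  \row_(j < n) (j.+1 == k)%:R.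

Definition bilinear_of (K : fieldType) (n : nat) (T : mtable K)
    (u v : 'rV[K]_n) : 'rV[K]_n :=
  \sum_(i < n) \sum_(j < n) (u 0 i * v 0 j) *: T _ (@std_basis K n) i.+1 j.+1.

Lemma bilinear_of_bilinear (K : fieldType) (n : nat) (T : mtable K) :
  bilinear_map (@bilinear_of K n T).
Proof.
split=> w a u v /=; rewrite /bilinear_of scaler_sumr -big_split /=.
  apply: eq_bigr => i _; rewrite scaler_sumr -big_split /=.
  by apply: eq_bigr => j _; rewrite !mxE mulrDl scalerDl -mulrA scalerA.
apply: eq_bigr => i _; rewrite scaler_sumr -big_split /=.
by apply: eq_bigr => j _; rewrite !mxE mulrDr scalerDl mulrCA scalerA.
Qed.

(* The automatic mode would look through mtable and make its argument V      *)
(* implicit in every table below.                                             *)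
Unset Implicit Arguments.

Definition Fn2_mtable (K : fieldType) (n : nat) : mtable K := fun V x i j =>
  if ((j == 1) && (1 <= i <= n - 2))%N then x i.+1 else 0.

Lemma Fn2_leibniz (K : fieldType) (n : nat) (x y z : 'rV[K]_n)
    (mu := @bilinear_of K n (Fn2_mtable K n)) :
  mu x (mu y z) = mu (mu x y) z - mu (mu x z) y.
Proof.
pose c (v : 'rV[K]_n) := \sum_(j < n | (j : nat) == 0%N) v 0 j.
pose S (u : 'rV[K]_n) :=
  \sum_(i < n) u 0 i *: Fn2_mtable K n _ (@std_basis K n) i.+1 1.
have muE u v : mu u v = c v *: S u.
  rewrite /mu /bilinear_of /c scaler_suml exchange_big /= [RHS]big_mkcond.
  apply: eq_bigr => j _; rewrite /S scaler_sumr; case: ifP => [/eqP j0|j0].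
    by apply: eq_bigr => i _; rewrite j0 scalerA mulrC.
  by apply: big1 => i _; rewrite /Fn2_mtable eqSS j0 scaler0.
have SZ a u : S (a *: u) = a *: S u.
  by rewrite /S scaler_sumr; apply: eq_bigr => i _; rewrite mxE scalerA.
have cS a u : c (a *: S u) = 0.
  rewrite /c big1 // => j /eqP j0; rewrite mxE summxE big1 ?mulr0 // => i _.
  rewrite mxE /Fn2_mtable; case: ifP => _; rewrite !mxE ?mulr0 //.
  by rewrite j0 mulr0.
by rewrite !muE cS scale0r !SZ !scalerA mulrC subrr.
Qed.

Definition Fn2 (K : fieldType) (n : nat) : leibnizAlg 'rV[K]_n :=
  LeibnizAlg (@bilinear_of_bilinear K n (Fn2_mtable K n)) (Fn2_leibniz K n).

Definition phi_mtable (K : fieldType) (j k : nat) : mtable K := fun V x p q =>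
  if ((p == j) && (q == 1))%N then x k else 0.

Definition psi_mtable (K : fieldType) (n k : nat) : mtable K := fun V x p q =>
  if (k == 1)%N then
    if ((p == n) && (q == 1))%N then x 1%N
    else if ((1 <= p <= n - 1) && (q == n))%N then - p%:R *: x p
    else 0
  else if (2 <= k <= n - 1)%N then
    if ((1 <= p <= n - k) && (q == n))%N then x (k + p - 1)%N else 0
  else if (k == n)%N then
    if ((p == 1) && (q == n))%N then x n else 0
  else if (k == n.+1)%N then
    if ((p == n) && (q == n))%N then x (n - 1)%N else 0
  else if (k == n.+2)%N then
    if ((p == n) && (q == n))%N then x n else 0
  else 0.

(* Membership in the span W of phi_(n,n), phi_(n-1,k) and psi_k. *)
Definition in_W (K : fieldType) (n : nat)
    (f : 'rV[K]_n -> 'rV[K]_n -> 'rV[K]_n) : Prop :=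
  exists (c : K) (a b : nat -> K), forall u v : 'rV[K]_n,
    f u v = c *: bilinear_of (phi_mtable K n n) u v
      + \sum_(2 <= k < n.+1) a k *: bilinear_of (phi_mtable K (n - 1) k) u v
      + \sum_(1 <= k < n.+3) b k *: bilinear_of (psi_mtable K n k) u v.

Definition F1_mtable (K : fieldType) (n : nat) (theta : K) (alpha : nat -> K) :
    mtable K := fun V x i j =>
  if ((j == 1) && (2 <= i <= n - 1))%N then x i.+1
  else if ((i == 1) && (j == 2))%N then theta *: x n
  else if ((j == 2) && (2 <= i <= n - 2))%N then
    \sum_(4 <= k < (n + 2 - i).+1) alpha k *: x (i + k - 2)%N
  else 0.

Definition F2_mtable (K : fieldType) (n : nat) (beta : nat -> K) (gamma : K) :
    mtable K := fun V x i j =>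
  if ((j == 1) && (1 <= i <= n - 2))%N then x i.+1
  else if ((j == n) && (1 <= i <= n - 3))%N then
    \sum_(3 <= k < (n - i).+1) beta k *: x (i + k - 1)%N
  else if ((i == n) && (j == n))%N then gamma *: x (n - 1)%N
  else 0.

Definition mu_tilde_mtable (K : fieldType) (n : nat) (a : nat -> K) :
    mtable K := fun V x i j =>
  if ((j == 1) && (1 <= i <= n - 1))%N then x i.+1
  else if ((i == n) && (j == 1))%N then \sum_(2 <= k < n.+1) a k *: x k
  else 0.

(* The direct sum of an (n-1)-dimensional algebra, with basis x 1 .. x (n-1)   *)
(* and table T, and of the abelian algebra spanned by x n.                     *)
Definition oplus_abelian_mtable (K : fieldType) (n : nat) (T : mtable K) :
    mtable K := fun V x i j =>
  if ((i <= n - 1) && (j <= n - 1))%N then T V x i j else 0.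

Definition nu1_mtable (K : fieldType) (n : nat) (a : nat -> K) :
    mtable K := fun V x i j =>
  if ((j == 1) && (1 <= i <= n - 2))%N then x i.+1
  else if ((i == n - 1) && (j == 1))%N then \sum_(2 <= k < n) a k *: x k
  else if ((i == n) && (j == 1))%N then x n
  else 0.

Definition nu2_mtable (K : fieldType) (n : nat) : mtable K := fun V x i j =>
  if ((j == 1) && (1 <= i <= n - 2))%N then x i.+1
  else if ((i == n) && (j == 1))%N then x 1%N
  else if ((j == n) && (1 <= i <= n - 1))%N then - i%:R *: x i
  else 0.

Definition nu3_mtable (K : fieldType) (n : nat) (b : nat -> K) :
    mtable K := fun V x i j =>
  if ((j == 1) && (1 <= i <= n - 2))%N then x i.+1
  else if ((i == n - 1) && (j == 1))%N then - x (n - 1)%N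
  else if ((i == n) && (j == 1))%N then - x n
  else if ((i == 1) && (j == n))%N then x n + \sum_(2 <= k < n) b k *: x k
  else if ((j == n) && (2 <= i <= n - 2))%N then
    \sum_(2 <= k < (n - i).+1) b k *: x (k + i - 1)%N
  else 0.

Definition nu4_mtable (K : fieldType) (n : nat) : mtable K := fun V x i j =>
  if ((j == 1) && (1 <= i <= n - 2))%N then x i.+1
  else if ((i == n - 1) && (j == 1))%N then - 2%:R *: x (n - 1)%N
  else if ((i == n) && (j == 1))%N then - x n
  else if ((i == 1) && (j == n))%N then x n
  else if ((i == n) && (j == n))%N then x (n - 1)%N
  else 0.

Definition nu5_mtable (K : fieldType) (n : nat) (a : nat -> K) :
    mtable K := fun V x i j =>
  if ((j == 1) && (1 <= i <= n - 2))%N then x i.+1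
  else if ((i == n - 1) && (j == 1))%N then \sum_(2 <= k < n) a k *: x k
  else if ((i == n) && (j == 1))%N then - x n
  else if ((i == 1) && (j == n))%N then x n
  else 0.

(* The first non-zero entry of (b_2, ..., b_(n-1)), if there is one, is 1. *)
Definition first_nonzero_eq1 (K : fieldType) (n : nat) (b : nat -> K) : Prop :=
  forall k, (2 <= k <= n - 1)%N -> b k != 0 ->
    (forall j, (2 <= j < k)%N -> b j = 0) -> b k = 1.

(* Main.v *)
Require Import Defs.
From mathcomp Require Import all_boot all_order all_algebra.
From mathcomp Require Import reals complex.
From mathcomp Require Import zify ring.

Set Implicit Arguments.
Unset Strict Implicit.
Unset Printing Implicit Defensive.

Import GRing.Theory Num.Theory.
Local Open Scope ring_scope.

(** Let L be the deformed algebra and let R_v be right multiplication by v.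
    R_{x_1} and R_{x_n} are the only R_{x_i} that can be non-zero. The first
    one moves x_i to x_{i+1} along the chain x_1, ..., x_{n-1}, then x_{n-1}
    to A = sum_k a_k x_k and x_n to c x_n + b_1 x_1. The second one
    multiplies x_i by - i b_1 and adds the polynomial sum_k b_k N^{k-1} of
    the shift N of the chain; moreover [x_1, x_n] has the extra term b_n
    x_n, and [x_n, x_n] = b_{n+1} x_{n-1} + b_{n+2} x_n. The identity
    R_{[y,z]} = R_z R_y - R_y R_z, applied to the basis vectors, turns into
    equations between the scalars a_k, b_k and c, and the theorem is a case
    analysis of these equations followed by changes of basis.

    If R_{x_n} = 0, the algebra is given by the single operator R_{x_1}.  When
    x_1 or x_1 + x_n is a cyclic vector, its iterates are a basis of type
    mu_tilde.  Otherwise the chain is stable and x_n is an eigenvector whose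
    eigenvalue c is also an eigenvalue of the chain; this is the direct sum
    when c = 0 and nu_1 when c is rescaled to 1 ([right_n_eq0_cases]).

    If R_{x_n} is not 0, then a_n = b_{n+2} = 0 and b_n = - c, because each of
    a_n, b_{n+2} and c + b_n annihilates R_{x_n}.  What is left of the Leibniz
    identity is the commutation rule
    R_{x_1} R_{x_n} - R_{x_n} R_{x_1} = c R_{x_n} + b_1 R_{x_1}
    ([leibniz_n1]), and its coordinates are [chain_coef_eq], [top_coef_eq] and
    [last_coef_eq].  They leave the following possibilities.
    - b_1 is not 0.  All other coefficients vanish, up to b_{n+1}, which a
      change of x_n removes: this is nu_2.
    - b_1 = 0 and c is not 0.  Either b_{n-1} is not 0, and then it is the only
      b_k with 2 <= k <= n-1, which gives nu_3; or all these b_k vanish, and the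
      algebra is nu_4 or nu_5 according to whether b_{n+1} vanishes.
    - b_1 = c = 0.  Then A = 0 and both operators commute.  If b_2 = 0 the table
      is that of F_2.  If b_2 is not 0, then R_{x_n} itself acts on the chain as
      a shift, and exchanging the roles of x_1 and x_n gives F_1
      ([F1_normal_form]).

    Characteristic 0 enters when b_1 is not 0, and square roots enter in the
    normalisation of nu_4. *)

(** * Brackets and multiplication tables *)

Section Tables.

Variables (K : fieldType) (V : vectType K) (n : nat) (L : leibnizAlg V).

Lemma brDl u v w : L (u + v) w = L u w + L v w.
Proof. exact: bilinear_mapDl (lbracket_bilinear L) u v w. Qed.

Lemma brDr u v w : L u (v + w) = L u v + L u w.
Proof. exact: bilinear_mapDr (lbracket_bilinear L) u v w. Qed.

Lemma br0l w : L 0 w = 0.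
Proof. by apply: (addrI (L 0 w)); rewrite -brDl !addr0. Qed.

Lemma br0r u : L u 0 = 0.
Proof. by apply: (addrI (L u 0)); rewrite -brDr !addr0. Qed.

Lemma brZl k u w : L (k *: u) w = k *: L u w.
Proof.
by have [/(_ w k u 0)/= + _] := lbracket_bilinear L; rewrite br0l !addr0.
Qed.

Lemma brZr k u w : L u (k *: w) = k *: L u w.
Proof.
by have [_ /(_ u k w 0)/=] := lbracket_bilinear L; rewrite br0r !addr0.
Qed.

Lemma brNl u w : L (- u) w = - L u w.
Proof. by rewrite -scaleN1r brZl scaleN1r. Qed.

Lemma brNr u w : L u (- w) = - L u w.
Proof. by rewrite -scaleN1r brZr scaleN1r. Qed.

Lemma br_suml (I : Type) (r : seq I) (P : pred I) (F : I -> V) w :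
  L (\sum_(i <- r | P i) F i) w = \sum_(i <- r | P i) L (F i) w.
Proof. by apply: (big_morph (L^~ w)) => [u v|]; rewrite ?brDl ?br0l. Qed.

Lemma br_sumr (I : Type) (r : seq I) (P : pred I) (F : I -> V) w :
  L w (\sum_(i <- r | P i) F i) = \sum_(i <- r | P i) L w (F i).
Proof. by apply: (big_morph (L w)) => [u v|]; rewrite ?brDr ?br0r. Qed.

Definition brl := (brDl, brZl, brNl, br0l).
Definition brr := (brDr, brZr, brNr, br0r).

Definition has_table_on (T : mtable K) (x : nat -> V) : Prop :=
  forall i j, (1 <= i <= n)%N -> (1 <= j <= n)%N -> L (x i) (x j) = T V x i j.

Definition family_span (x : nat -> V) : {vspace V} :=
  <<mkseq (fun k => x k.+1) n>>%VS.

(** An arbitrary table may read its family of vectors at any index, whereas a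
    basis only fixes the entries 1, ..., n.  Locality allows a table verified on
    a family to be transferred to the tuple that [has_mtable] asks for. *)
Definition local_table (T : mtable K) : Prop :=
  forall x y : nat -> V, (forall k, (1 <= k <= n)%N -> x k = y k) ->
  forall i j, (1 <= i <= n)%N -> (1 <= j <= n)%N -> T V x i j = T V y i j.

Lemma mem_family_span (x : nat -> V) k :
  (1 <= k <= n)%N -> x k \in family_span x.
Proof.
case: k => // k /= lekn; apply/memv_span/mapP; exists k => //.
by rewrite mem_iota.
Qed.

Lemma has_mtableI (T : mtable K) (x : nat -> V) :
  \dim {:V} = n -> family_span x = fullv -> local_table T ->
  has_table_on T x -> has_mtable n L T.
Proof.
move=> dimV spanx locT tabx.
have sz : size (mkseq (fun k => x k.+1) n) == n by rewrite size_mkseq.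
have XE k : (1 <= k <= n)%N -> (mkseq (fun k => x k.+1) n)`_k.-1 = x k.
  by case: k => // k lekn; rewrite nth_mkseq.
exists (Tuple sz) => [|y i j Hi Hj].
  by rewrite basisEdim /= (eqP sz) dimV leqnn andbT -spanx.
by rewrite (locT y x) // /y /= !XE // tabx.
Qed.

Lemma has_mtable_eq (T T' : mtable K) :
  (forall (x : nat -> V) i j, (1 <= i <= n)%N -> (1 <= j <= n)%N ->
    T V x i j = T' V x i j) ->
  has_mtable n L T -> has_mtable n L T'.
Proof.
by move=> eqT [X bX tX]; exists X => // x i j Hi Hj; rewrite -eqT // -tX.
Qed.

Lemma family_span_full (x y : nat -> V) :
  family_span x = fullv ->
  (forall k, (1 <= k <= n)%N -> x k \in family_span y) ->
  family_span y = fullv.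
Proof.
move=> spanx xy; apply/eqP; rewrite eqEsubv subvf -spanx; apply/span_subvP.
by move=> _ /mapP[k + ->]; rewrite mem_iota => /andP[_ lekn]; apply: xy.
Qed.

(** Coordinate forms of a basis, indexed by natural numbers like the basis: all
    equations between structure constants are read off through them. *)
Lemma dual_family (x : nat -> V) :
  \dim {:V} = n -> family_span x = fullv ->
  exists co : nat -> {scalar V}, forall k m,
    (1 <= k <= n)%N -> (1 <= m <= n)%N -> co k (x m) = (k == m)%:R.
Proof.
move=> dimV spanx.
have sz : size (mkseq (fun k => x k.+1) n) == n by rewrite size_mkseq.
have freeX : free (Tuple sz).
  by rewrite /free /= (eqP sz) -/(family_span x) spanx dimV.
exists (fun k =>
  if insub k.-1 is Some i then (coord (Tuple sz) i : {scalar V}) else \0).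
move=> [//|k] [//|m] /= lekn lemn; rewrite insubT /=.
have -> : x m.+1 = (Tuple sz)`_(Ordinal lemn) by rewrite /= nth_mkseq.
by rewrite coord_free // eqSS eq_sym.
Qed.

End Tables.

(** * The table of the deformed algebra *)

Section DeformTable.

Variables (K : fieldType) (n : nat).

Unset Implicit Arguments.

(** The common shape of the tables of all deformations by an element of W, with
    the coefficients of phi as parameters: a for the phi_(n-1,k), b for the
    psi_k and c for phi_(n,n).  It is stable under the rescalings of the basis,
    so that most normal forms are reached without leaving it. *)
Definition deform_mtable (a b : nat -> K) (c : K) : mtable K := fun V x i j =>
  if j == 1%N then
    if i == n then c *: x n + b 1%N *: x 1%N
    else if i == (n - 1)%N then \sum_(2 <= k < n.+1) a k *: x k
    else x i.+1
  else if j == n then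
    if i == n then b n.+1 *: x (n - 1)%N + b n.+2 *: x n
    else - (i%:R * b 1%N) *: x i
      + \sum_(2 <= k < (n - i).+1) b k *: x (k + i - 1)%N
      + (if i == 1%N then b n else 0) *: x n
  else 0.

Set Implicit Arguments.

Lemma local_deform (V : vectType K) a b c :
  (4 <= n)%N -> local_table V n (deform_mtable a b c).
Proof.
move=> hn x y exy i j Hi Hj; rewrite /deform_mtable.
have sE f p q s : (2 <= p)%N -> (q + s <= n.+2)%N -> (0 < s)%N ->
    \sum_(p <= k < q) f k *: x (k + s - 1)%N =
    \sum_(p <= k < q) f k *: y (k + s - 1)%N.
  by move=> *; apply: eq_big_nat => k Hk; rewrite exy //; lia.
have sA : \sum_(2 <= k < n.+1) a k *: x k = \sum_(2 <= k < n.+1) a k *: y k.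
  by apply: eq_big_nat => k Hk; rewrite exy //; lia.
case: eqP => _; last case: eqP => // _.
  by case: eqP => ?; last case: eqP => ?; rewrite ?sA ?exy //; lia.
by case: eqP => ?; rewrite ?sE ?exy //; lia.
Qed.

Lemma std_basisE k (i : 'I_n) : @std_basis K n k 0 i = (i.+1 == k)%:R.
Proof. by rewrite mxE. Qed.

Lemma bilinear_of_std (T : mtable K) i j :
  (1 <= i <= n)%N -> (1 <= j <= n)%N ->
  @bilinear_of K n T (@std_basis K n i) (@std_basis K n j) =
  T _ (@std_basis K n) i j.
Proof.
case: i j => [//|i] [//|j] /= lti ltj; rewrite /bilinear_of.
rewrite (bigD1 (Ordinal lti)) //= (bigD1 (Ordinal ltj)) //=.
rewrite !std_basisE !eqxx mulr1 scale1r !big1 ?addr0 // => k nek.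
  rewrite big1 // => l _; rewrite std_basisE eqSS.
  by move: nek; rewrite -val_eqE => /negPf/= ->; rewrite mul0r scale0r.
rewrite !std_basisE [k.+1 == _]eqSS.
by move: nek; rewrite -val_eqE => /negPf/= ->; rewrite mulr0 scale0r.
Qed.

Lemma std_basis_span : family_span (V := 'rV[K]_n) n (@std_basis K n) = fullv.
Proof.
apply/eqP; rewrite eqEsubv subvf; apply/subvP => v _.
rewrite (row_sum_delta v); apply: memv_suml => i _; apply: memvZ.
have -> : delta_mx 0 i = @std_basis K n i.+1.
  by apply/rowP => j; rewrite !mxE eqSS.
by apply: mem_family_span; rewrite ltn_ord.
Qed.

End DeformTable.

Section InitialTable.

Variables (K : fieldType) (n : nat).
Hypothesis hn : (4 <= n)%N.

(** The cocycles psi_2, ..., psi_{n-1} together act as a polynomial in the shift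
    of the chain.  The bound k <= n - i on the sum expresses that the chain
    stops at x_{n-1}. *)
Lemma psi_middle (V : lmodType K) (x : nat -> V) (b : nat -> K) i j :
  (1 <= i <= n)%N ->
  \sum_(2 <= k < n) b k *: psi_mtable K n k V x i j =
  if j == n then \sum_(2 <= k < (n - i).+1) b k *: x (k + i - 1)%N else 0.
Proof.
move=> Hi; have psiE k : (2 <= k < n)%N -> psi_mtable K n k V x i j =
    if (i <= n - k)%N && (j == n) then x (k + i - 1)%N else 0.
  move=> Hk; rewrite /psi_mtable.
  have [-> ->] : (k == 1%N) = false /\ (2 <= k <= n - 1)%N by lia.
  by have -> : (1 <= i <= n - k)%N = (i <= n - k)%N by lia.
rewrite (eq_big_nat _ _ (fun k Hk => congr1 _ (psiE k Hk))).
case: eqP => _; last by rewrite big1 // => k _; rewrite andbF scaler0.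
have [lein|leni] := leqP i (n - 2); last first.
  rewrite [RHS]big_geq; last by lia.
  rewrite big_nat big1 // => k Hk.
  by have -> : (i <= n - k)%N = false; rewrite ?scaler0 //; lia.
have [le2 len] : (2 <= (n - i).+1)%N /\ ((n - i).+1 <= n)%N by lia.
rewrite (@big_cat_nat _ _ _ _ _ _ _ _ le2 len) /= [X in _ + X]big_nat.
rewrite [X in _ + X]big1 ?addr0 => [|k Hk].
  by apply: eq_big_nat => k Hk; have -> : (i <= n - k)%N by lia.
by have -> : (i <= n - k)%N = false; rewrite ?scaler0 //; lia.
Qed.

Lemma deformation_table (phi : 'rV[K]_n -> 'rV[K]_n -> 'rV[K]_n)
    (phiP : linear_integrable_deformation (Fn2 K n) phi) :
  in_W K n phi ->
  exists a b c, has_table_on n (deformation phiP) (deform_mtable K n a b c)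
                  (@std_basis K n).
Proof.
move=> [c [a [b phiE]]]; exists a, b, c => i j Hi Hj /=.
rewrite {}phiE !bilinear_of_std //.
under eq_bigr do rewrite bilinear_of_std //.
under [X in _ + (_ + X)]eq_bigr do rewrite bilinear_of_std //.
move: {phi phiP} (@std_basis K n) => x.
have [E1 [E2 [E3 [E4 [E5 E6]]]]] : (n.+1 <= n - 1)%N = false /\
    (n.+2 <= n - 1)%N = false /\ (n.+1 == n) = false /\
    (n.+2 == n) = false /\ (n.+2 == n.+1) = false /\ (n == 1)%N = false by lia.
have [E7 [E8 E9]] : (n <= n - 1)%N = false /\ (n.+1 == 1)%N = false /\
    (n.+2 == 1)%N = false by lia.
have [E10 [E11 E12]] : (n <= n - 2)%N = false /\ (n == n - 1)%N = false /\
    (n - 1 <= n - 2)%N = false by lia.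
have -> : \sum_(1 <= k < n.+3) b k *: psi_mtable K n k _ x i j =
    b 1%N *: (if (i == n) && (j == 1%N) then x 1%N
              else if (i != n) && (j == n) then - i%:R *: x i else 0)
    + (if j == n then \sum_(2 <= k < (n - i).+1) b k *: x (k + i - 1)%N else 0)
    + (if (i == 1%N) && (j == n) then b n *: x n else 0)
    + (if (i == n) && (j == n)
       then b n.+1 *: x (n - 1)%N + b n.+2 *: x n else 0).
  rewrite big_ltn // -addrA -addrA; congr (_ + _).
    rewrite /psi_mtable eqxx.
    by have -> // : (1 <= i <= n - 1)%N = (i != n) by lia.
  have [l1 [l2 l3]] : (2 <= n.+2 /\ 2 <= n.+1 /\ 2 <= n)%N by lia.
  rewrite 3?[in LHS]big_nat_recr //= psi_middle // -!addrA; congr (_ + (_ + _)).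
    by rewrite /psi_mtable E6 E7 andbF eqxx; case: ifP; rewrite ?scaler0.
  rewrite /psi_mtable E1 E2 E3 E4 E5 E8 E9 !andbF !eqxx.
  by case: ifP; rewrite ?scaler0 ?addr0.
have -> : \sum_(2 <= k < n.+1) a k *: phi_mtable K (n - 1) k _ x i j =
    if (i == n - 1)%N && (j == 1%N) then \sum_(2 <= k < n.+1) a k *: x k else 0.
  rewrite /phi_mtable; case: ifP => // _.
  by rewrite big1 // => k _; rewrite scaler0.
rewrite /deform_mtable /Fn2_mtable /phi_mtable.
have [->|j1] := eqVneq j 1%N.
  rewrite (eq_sym 1%N n) E6 !andbT !andbF !addr0.
  have [->|ni] := eqVneq i n.
    by rewrite E10 E11 andbF add0r addr0.
  rewrite !scaler0 add0r addr0; have [->|ni'] := eqVneq i (n - 1)%N.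
    by rewrite E12 andbF add0r.
  have -> : (1 <= i <= n - 2)%N by lia.
  by rewrite addr0.
rewrite !andbF scaler0 !add0r; have [jn|jn] := eqVneq j n; last first.
  by rewrite !andbF scaler0 !addr0.
rewrite !andbT; have [->|ni] := eqVneq i n.
  by rewrite E6 subnn big_geq // scaler0 !add0r.
rewrite addr0 scalerA mulrN mulrC; congr (_ + _).
by case: ifP; rewrite ?scale0r.
Qed.

End InitialTable.

(** * Right multiplications and rescaling *)

Section SpanningFamily.

Variables (K : fieldType) (V : vectType K) (n : nat) (x : nat -> V).
Hypothesis spanx : family_span n x = fullv.

Lemma family_span_sum v :
  exists f : nat -> K, v = \sum_(1 <= k < n.+1) f k *: x k.
Proof.
have : v \in family_span n x by rewrite spanx memvf.
have sz : size (mkseq (fun k => x k.+1) n) == n by rewrite size_mkseq.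
rewrite /family_span -[mkseq _ _]/(tval (Tuple sz)) => /coord_span vE.
exists (fun k => if insub k.-1 is Some i then coord (Tuple sz) i v else 0).
rewrite {1}vE big_add1 big_mkord; apply: eq_bigr => i _.
by rewrite valK /= nth_mkseq.
Qed.

Lemma bracket_eq0 (L : leibnizAlg V) w :
  (forall k, (1 <= k <= n)%N -> L (x k) w = 0) -> forall u, L u w = 0.
Proof.
move=> Lx0 u; have [f ->] := family_span_sum u; rewrite br_suml big_nat big1 //.
by move=> k Hk; rewrite brl Lx0 // scaler0.
Qed.

End SpanningFamily.

Section DeformedAlgebra.

Variables (K : fieldType) (V : vectType K) (n : nat).
Hypothesis hn : (4 <= n)%N.
Variables (L : leibnizAlg V) (x : nat -> V).
Hypothesis spanx : family_span n x = fullv.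
Variables (a b : nat -> K) (c : K).
Hypothesis tab : has_table_on n L (deform_mtable K n a b c) x.

Let A := \sum_(2 <= k < n.+1) a k *: x k.

Lemma br_chain i : (1 <= i <= n - 2)%N -> L (x i) (x 1%N) = x i.+1.
Proof.
move=> Hi; rewrite tab ?/deform_mtable /=; try lia.
by have [-> ->] : (i == n) = false /\ (i == n - 1)%N = false by lia.
Qed.

Lemma br_top : L (x (n - 1)%N) (x 1%N) = A.
Proof.
rewrite tab ?/deform_mtable /= ?eqxx; try lia.
by have -> : (n - 1 == n)%N = false by lia.
Qed.

Lemma br_n1 : L (x n) (x 1%N) = c *: x n + b 1%N *: x 1%N.
Proof. by rewrite tab ?/deform_mtable ?eqxx //; lia. Qed.

Lemma br_nn : L (x n) (x n) = b n.+1 *: x (n - 1)%N + b n.+2 *: x n.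
Proof.
rewrite tab ?/deform_mtable ?eqxx //; try lia.
by have -> : (n == 1)%N = false by lia.
Qed.

Lemma br_in i : (1 <= i <= n - 1)%N ->
  L (x i) (x n) = - (i%:R * b 1%N) *: x i
      + \sum_(2 <= k < (n - i).+1) b k *: x (k + i - 1)%N
      + (if i == 1%N then b n else 0) *: x n.
Proof.
move=> Hi; rewrite tab ?/deform_mtable ?eqxx //; try lia.
by have [-> ->] : (n == 1)%N = false /\ (i == n) = false by lia.
Qed.

Lemma br_ideal j u : (2 <= j <= n - 1)%N -> L u (x j) = 0.
Proof.
move=> Hj; apply: (bracket_eq0 spanx) => k Hk.
rewrite tab ?/deform_mtable //; try lia.
by have [-> ->] : (j == 1)%N = false /\ (j == n) = false by lia.
Qed.

Lemma deform_coef_eq (a1 b1 a' b' : nat -> K) (c1 c' : K) :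
  (forall k, (2 <= k <= n)%N -> a1 k = a' k) ->
  (forall k, (1 <= k <= n.+2)%N -> b1 k = b' k) -> c1 = c' ->
  has_mtable n L (deform_mtable K n a1 b1 c1) ->
  has_mtable n L (deform_mtable K n a' b' c').
Proof.
move=> aE bE ->; apply: has_mtable_eq => y i j Hi Hj.
rewrite /deform_mtable !bE; try lia.
have -> : \sum_(2 <= k < n.+1) a1 k *: y k = \sum_(2 <= k < n.+1) a' k *: y k.
  by apply: eq_big_nat => k Hk; rewrite aE.
have -> // : \sum_(2 <= k < (n - i).+1) b1 k *: y (k + i - 1)%N =
    \sum_(2 <= k < (n - i).+1) b' k *: y (k + i - 1)%N.
by apply: eq_big_nat => k Hk; rewrite bE //; lia.
Qed.

Hypothesis dimV : \dim {:V} = n.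

Lemma has_deform : has_mtable n L (deform_mtable K n a b c).
Proof. by apply: has_mtableI tab => //; apply: local_deform. Qed.

(** Since [x_i, x_1] = x_{i+1}, a rescaling of x_1 by s forces x_i to be
    multiplied by s^i along the chain, while x_n may be multiplied by any t. *)
Lemma deform_scale s t : s != 0 -> t != 0 ->
  has_mtable n L (deform_mtable K n
    (fun k => if k == n then s ^+ n / t * a n else s ^+ (n - k) * a k)
    (fun k => if k == n then s * b n
              else if k == n.+1 then t ^+ 2 / s ^+ (n - 1) * b n.+1
              else if k == n.+2 then t * b n.+2
              else t * s / s ^+ k * b k)
    (s * c)).
Proof.
move=> s0 t0; pose d (k : nat) : K := if k == n then t else s ^+ k.
pose y (k : nat) := d k *: x k.
have d0 k : d k != 0 by rewrite /d; case: (k == n) => //; apply: expf_neq0.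
have d_n : d n = t by rewrite /d eqxx.
have dE k : (k < n)%N -> d k = s ^+ k by move=> ?; rewrite /d ltn_eqF.
have xE k : x k = (d k)^-1 *: y k by rewrite scalerA mulVf ?scale1r.
apply: (has_mtableI (x := y)) => //; last first.
- move=> i j Hi Hj; rewrite /y !brl !brr tab // /deform_mtable -/(y _).
  have [->|j1] := eqVneq j 1%N.
    rewrite (dE 1%N); last by lia.
    have [->|ni] := eqVneq i n.
      rewrite !xE (dE 1%N); last by lia.
      rewrite d_n !scalerDr !scalerA.
      have -> : (1 == n)%N = false by lia.
      have -> : (1 == n.+1)%N = false by lia.
      have -> : (1 == n.+2)%N = false by lia.
      by congr (_ *: _ + _ *: _); field; rewrite ?s0 ?t0.
    have [in1|ni'] := eqVneq i (n - 1)%N.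
      rewrite in1 (dE (n - 1)%N); last by lia.
      rewrite !scaler_sumr; apply: eq_big_nat => k Hk.
      rewrite (xE k) !scalerA; have [->|nk] := eqVneq k n.
        have -> : s ^+ n = s ^+ (n - 1) * s.
          by rewrite -exprSr; congr (_ ^+ _); lia.
        by rewrite d_n; congr (_ *: _); field.
      rewrite (dE k); last by lia.
      have -> : s ^+ (n - 1) * s ^+ 1 = s ^+ (n - k) * s ^+ k.
        by rewrite -!exprD; congr (_ ^+ _); lia.
      by congr (_ *: _); field; apply: expf_neq0.
    rewrite xE (dE i) ?(dE i.+1) ?scalerA; try lia.
    by rewrite -exprD addn1 divff ?scale1r ?expf_neq0.
  have [jn|jn] := eqVneq j n; last by rewrite !scaler0.
  rewrite {}jn.
  have [E1 [E2 E3]] : (n.+2 == n) = false /\ (n.+1 == n) = false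
    /\ (n.+2 == n.+1) = false by lia.
  rewrite d_n; have [->|ni] := eqVneq i n.
    rewrite !xE d_n dE; last by lia.
    rewrite !scalerDr !scalerA E1 E2 E3 !eqxx.
    by congr (_ *: _ + _ *: _); field; rewrite ?expf_neq0 ?t0.
  have lin : (i < n)%N by lia.
  have [F1 [F2 F3]] : (1 == n)%N = false /\ (1 == n.+1)%N = false
    /\ (1 == n.+2)%N = false by lia.
  rewrite !scalerDr F1 F2 F3 eqxx.
  rewrite !xE d_n dE // !scalerA; congr (_ *: _ + _ + _ *: _).
  + by field; rewrite ?expf_neq0 ?s0.
  + rewrite !scaler_sumr; apply: eq_big_nat => k Hk.
    have [-> [-> ->]] : (k == n) = false /\ (k == n.+1) = false
      /\ (k == n.+2) = false by lia.
    rewrite xE dE ?scalerA; last by lia.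
    have -> : s ^+ i = s ^+ (k + i - 1) * s / s ^+ k.
      rewrite -exprSr; have -> : ((k + i - 1).+1 = i + k)%N by lia.
      by rewrite exprD mulfK ?expf_neq0.
    by congr (_ *: _); field; rewrite !expf_neq0.
  by case: eqP => [->|_]; [field | ring].
- exact: local_deform.
apply: (family_span_full spanx) => k Hk; rewrite xE memvZ //.
exact: mem_family_span.
Qed.

(** * Algebras in which x_n annihilates on the right *)

Lemma local_mu_tilde a' : local_table V n (mu_tilde_mtable K n a').
Proof.
move=> y z exy i j Hi Hj; rewrite /mu_tilde_mtable.
have -> : \sum_(2 <= k < n.+1) a' k *: y k = \sum_(2 <= k < n.+1) a' k *: z k.
  by apply: eq_big_nat => k Hk; rewrite exy //; lia.
by case: ifP => // E; rewrite exy //; lia.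
Qed.

(** The family y consists of the iterates of u = x_1 + t x_n under R_{x_1}.
    With p = X^{n-1} - sum_(2 <= k < n) a_k X^{k-1}, the scalar d assumed to be
    non-zero satisfies p(R_{x_1}) u = d x_n.  So x_n lies in the span of the
    iterates, and then so does the chain. *)
Lemma cyclic_normal_form t :
  (forall k, (1 <= k <= n.+2)%N -> b k = 0) ->
  a n + t * (c ^+ (n - 1) - \sum_(2 <= k < n) a k * c ^+ (k - 1)) != 0 ->
  exists a', has_mtable n L (mu_tilde_mtable K n a').
Proof.
set d := a n + _ => b0 d0.
have Lxn u : L u (x n) = 0.
  apply: (bracket_eq0 spanx) => k Hk; have [->|kn] := eqVneq k n.
    by rewrite br_nn !b0 ?scale0r ?addr0 //; lia.
  rewrite br_in ?b0; try lia.
  rewrite mulr0 oppr0 if_same !scale0r add0r addr0 big_nat big1 // => i Hi.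
  by rewrite b0 ?scale0r //; lia.
have Lxn1 : L (x n) (x 1%N) = c *: x n.
  by rewrite br_n1 b0 ?scale0r ?addr0 //; lia.
pose y k := (if k == n then A else x k) + (t * c ^+ (k - 1)) *: x n.
have yE k : (k < n)%N -> y k = x k + (t * c ^+ (k - 1)) *: x n.
  by move=> lt; rewrite /y ltn_eqF.
have y_n : y n = A + (t * c ^+ (n - 1)) *: x n by rewrite /y eqxx.
have Ly1 i : (1 <= i <= n - 1)%N -> L (y i) (x 1%N) = y i.+1.
  move=> Hi; rewrite yE; last by lia.
  rewrite !brl Lxn1 scalerA -mulrA -exprSr.
  have -> : (i - 1).+1 = (i.+1 - 1)%N by lia.
  have [->|ni] := eqVneq i (n - 1)%N.
    by rewrite br_top (_ : (n - 1).+1 = n) ?y_n //; lia.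
  by rewrite br_chain ?yE //; lia.
have AE : A = \sum_(2 <= k < n) a k *: x k + a n *: x n.
  by rewrite /A big_nat_recr //; lia.
(* p(R_{x_1}) u, computed on the iterates of u. *)
have dxn : d *: x n = y n - \sum_(2 <= k < n) a k *: y k.
  rewrite y_n AE.
  have -> : \sum_(2 <= k < n) a k *: y k = \sum_(2 <= k < n) a k *: x k
      + (t * \sum_(2 <= k < n) a k * c ^+ (k - 1)) *: x n.
    rewrite mulr_sumr scaler_suml -big_split; apply: eq_big_nat => k Hk /=.
    by rewrite yE ?scalerDr ?scalerA; [congr (_ + _ *: _); ring | lia].
  rewrite opprD addrACA -addrA addrACA subrr add0r -scaleNr -!scalerDl.
  by congr (_ *: _); rewrite /d; ring.
have Lyn : L (y n) (x 1%N) = \sum_(2 <= k < n) a k *: y k.+1 + (c * d) *: x n.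
  rewrite y_n AE !brl br_suml Lxn1.
  have -> : \sum_(2 <= k < n) a k *: y k.+1 =
    \sum_(2 <= k < n) L (a k *: x k) (x 1%N) +
      (t * c * \sum_(2 <= k < n) a k * c ^+ (k - 1)) *: x n.
    rewrite mulr_sumr scaler_suml -big_split; apply: eq_big_nat => k Hk /=.
    rewrite -Ly1 ?yE ?brl ?Lxn1 ?scalerDr ?scalerA; try lia.
    by congr (_ + _ *: _); ring.
  rewrite -!addrA; congr (_ + _); rewrite !scalerA -!scalerDl.
  by congr (_ *: _); rewrite /d; ring.
have xn_y : x n \in family_span n y.
  rewrite -[x n]scale1r -(mulVf d0) -scalerA memvZ // dxn memvB //.
    by rewrite mem_family_span //; lia.
  rewrite big_nat memv_suml // => k Hk.
  by rewrite memvZ // mem_family_span //; lia.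
pose a' k := (if (3 <= k)%N then a (k - 1)%N else 0)
  + (if k == n then c else - (c * a k)).
exists a'; apply: (has_mtableI (x := y)) => //.
- apply: (family_span_full spanx) => k Hk; have [->//|kn] := eqVneq k n.
  have -> : x k = y k - (t * c ^+ (k - 1)) *: x n.
    by rewrite yE ?addrK //; lia.
  by rewrite memvB ?memvZ ?mem_family_span.
- exact: local_mu_tilde.
move=> i j Hi Hj; rewrite /mu_tilde_mtable.
have [->|j1] := eqVneq j 1%N; last first.
  rewrite !andbF [y j]/y !brr Lxn scaler0 addr0; case: eqP => jn.
    rewrite /A br_sumr big_nat big1 // => k Hk; rewrite brr.
    have [->|kn] := eqVneq k n; first by rewrite Lxn scaler0.
    by rewrite br_ideal ?scaler0 //; lia.
  by rewrite br_ideal //; lia.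
rewrite [y 1%N]yE ?brr ?Lxn ?scaler0 ?addr0; last by lia.
have [->|ni] := eqVneq i n; last first.
  have -> /= : (1 <= i <= n - 1)%N by lia.
  by rewrite Ly1 //; lia.
have -> /= : (1 <= n <= n - 1)%N = false by lia.
rewrite Lyn -scalerA dxn; under [RHS]eq_bigr do rewrite scalerDl.
rewrite big_split /=; congr (_ + _).
  rewrite [RHS]big_ltn; last by lia.
  rewrite /= scale0r add0r [RHS]big_add1; apply: eq_big_nat => k Hk /=.
  by have [-> ->] : (2 < k.+1)%N /\ (k.+1 - 1 = k)%N by lia.
rewrite big_nat_recr /=; last by lia.
rewrite eqxx addrC scalerBr scaler_sumr -sumrN; congr (_ + _).
apply: eq_big_nat => k Hk; have -> : (k == n) = false by lia.
by rewrite scalerA scaleNr.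
Qed.

(** The values t = 0 and t = 1 suffice: if x_1 and x_1 + x_n both fail to be
    cyclic, then a_n = 0 and c is a root of X^{n-1} - sum_k a_k X^{k-1}.  For c
    non-zero, the rescaling that makes c equal to 1 turns this root condition
    into the normalisation sum_k a_k = 1 of nu_1. *)
Lemma right_n_eq0_cases :
  (forall k, (1 <= k <= n.+2)%N -> b k = 0) ->
  [\/ exists a', has_mtable n L (mu_tilde_mtable K n a'),
      exists a', has_mtable n L
        (oplus_abelian_mtable K n (mu_tilde_mtable K (n - 1) a'))
    | exists2 a', \sum_(2 <= k < n) a' k = 1
      & has_mtable n L (nu1_mtable K n a')].
Proof.
move=> b0; have [an0|an0] := eqVneq (a n) 0; last first.
  constructor 1; apply: (cyclic_normal_form (t := 0)) => //.
  by rewrite mul0r addr0.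
set p := c ^+ (n - 1) - \sum_(2 <= k < n) a k * c ^+ (k - 1).
have [p0|p0] := eqVneq p 0; last first.
  constructor 1; apply: (cyclic_normal_form (t := 1)) => //.
  by rewrite an0 mul1r add0r.
have [c0|c0] := eqVneq c 0.
  constructor 2; exists a; apply: has_mtable_eq has_deform => y i j Hi Hj.
  rewrite /deform_mtable /oplus_abelian_mtable /mu_tilde_mtable c0.
  rewrite !b0 ?scale0r; try lia.
  have -> : (j <= n - 1)%N = (j != n) by lia.
  have -> : (i <= n - 1)%N = (i != n) by lia.
  have [->|j1] := eqVneq j 1%N.
    have -> : (1%N != n) by lia.
    rewrite andbT; case: eqP => [//|ni]; first by rewrite addr0.
    have -> : (n - 1).+1 = n by lia.
    rewrite big_nat_recr ?an0 ?scale0r ?addr0 /=; last by lia.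
    have [->|ni'] := eqVneq i (n - 1)%N.
      rewrite addr0.
      by have -> : (1 <= n - 1 <= n - 1 - 1)%N = false by lia.
    by have -> : (1 <= i <= n - 1 - 1)%N by lia.
  rewrite andbF /= if_same; case: (j == n); last by rewrite if_same.
  rewrite andbF mulr0 oppr0.
  rewrite !scale0r !addr0 add0r big_nat.
  by rewrite big1 ?if_same // => k Hk; rewrite b0 ?scale0r //; lia.
constructor 3; have s0 : c^-1 != 0 by rewrite invr_eq0.
exists (fun k => c^-1 ^+ (n - k) * a k).
  have -> : 1 = c^-1 ^+ (n - 1) * c ^+ (n - 1).
    by rewrite exprVn mulVf ?expf_neq0.
  move/eqP: p0; rewrite /p subr_eq0 => /eqP ->; rewrite mulr_sumr.
  apply: eq_big_nat => k Hk; rewrite !exprVn.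
  have -> : (n - 1 = n - k + (k - 1))%N by lia.
  by rewrite exprD; field; rewrite !expf_neq0.
have: has_mtable n L (deform_mtable K n
    (fun k => if k == n then 0 else c^-1 ^+ (n - k) * a k) (fun=> 0) 1).
  apply: deform_coef_eq (deform_scale s0 (oner_neq0 K)) => [k Hk|k Hk|].
  - by case: ifP => // _; rewrite an0 mulr0.
  - by rewrite !b0 ?mulr0 ?if_same //; lia.
  exact: mulVf.
apply: has_mtable_eq.
move=> y i j Hi Hj; rewrite /deform_mtable /nu1_mtable scale1r scale0r addr0.
have [_|j1] := eqVneq j 1%N.
  have [->|ni] := eqVneq i n.
    have -> : (n <= n - 2)%N = false by lia.
    have -> : (n == n - 1)%N = false by lia.
    by rewrite !andbF.
  have [->|ni'] := eqVneq i (n - 1)%N.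
    have -> : (n - 1 <= n - 2)%N = false by lia.
    rewrite big_nat_recr /=; last by lia.
    rewrite eqxx scale0r addr0 andbF; apply: eq_big_nat => k Hk.
    by have -> : (k == n) = false by lia.
  by have -> : (1 <= i <= n - 2)%N by lia.
rewrite !andbF /=; case: (j == n) => //; rewrite !scale0r mulr0 oppr0.
rewrite scale0r !add0r if_same scale0r addr0 big1 ?if_same // => k _.
by rewrite scale0r.
Qed.

(** * Equations between the structure constants *)

Section LeibnizEquations.

Variable co : nat -> {scalar V}.
Hypothesis coE : forall k m, (1 <= k <= n)%N -> (1 <= m <= n)%N ->
  co k (x m) = (k == m)%:R.

(** Every sum met below runs along the chain with a constant shift of indices,
    so that a coordinate form selects at most one of its terms. *)
Lemma co_sum f p q s k : (1 <= k <= n)%N -> (1 <= p)%N -> (1 <= s)%N ->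
  (q + s <= n.+2)%N ->
  co k (\sum_(p <= m < q) f m *: x (m + s - 1)%N) =
  if (p + s <= k.+1 < q + s)%N then f (k.+1 - s)%N else 0.
Proof.
move=> Hk Hp Hs Hq; rewrite linear_sum /=.
have cE m : (p <= m < q)%N ->
    co k (f m *: x (m + s - 1)%N) = if m == (k.+1 - s)%N then f m else 0.
  move=> Hm; rewrite linearZ /= coE //; last by lia.
  have -> : (k == m + s - 1)%N = (m == k.+1 - s)%N by lia.
  by case: ifP => _; rewrite ?mulr1 ?mulr0.
rewrite (eq_big_nat _ _ cE) -big_mkcond /= big_nat1_eq.
by have -> : (p <= k.+1 - s < q)%N = (p + s <= k.+1 < q + s)%N by lia.
Qed.

Lemma co_A k : (1 <= k <= n)%N -> co k A = if (2 <= k)%N then a k else 0.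
Proof.
move=> Hk; have -> : A = \sum_(2 <= m < n.+1) a m *: x (m + 1 - 1)%N.
  by apply: eq_big_nat => m _; rewrite addnK.
rewrite co_sum //; last by lia.
have -> : (2 + 1 <= k.+1 < n.+1 + 1)%N = (2 <= k)%N by lia.
by rewrite subn1.
Qed.

Lemma co_in i k : (1 <= i <= n - 1)%N -> (1 <= k <= n)%N ->
  co k (L (x i) (x n)) = - (i%:R * b 1%N) * (k == i)%:R
    + (if (i < k < n)%N then b (k.+1 - i)%N else 0)
    + (if i == 1%N then b n else 0) * (k == n)%:R.
Proof.
move=> Hi Hk; rewrite br_in // !linearD !linearZ /= !coE //; try lia.
rewrite co_sum //; try lia.
by have -> : (2 + i <= k.+1 < (n - i).+1 + i)%N = (i < k < n)%N by lia.
Qed.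

(** All the b_k are coordinates of [x_1, x_n] and [x_n, x_n]. *)
Lemma scaled_right_n_eq0 s : s != 0 -> (forall u, s *: L u (x n) = 0) ->
  forall k, (1 <= k <= n.+2)%N -> b k = 0.
Proof.
move=> s0 sL k Hk; have Lxn u : L u (x n) = 0.
  by apply/eqP; move/eqP: (sL u); rewrite scaler_eq0 (negPf s0).
have co0 m u : co m (L u (x n)) = 0 by rewrite Lxn linear0.
have [lekn|ltnk] := leqP k n.
  have := co0 k (x 1%N); rewrite co_in; try lia.
  have [->|k1] := eqVneq k 1%N.
    have -> : (1 == n)%N = false by lia.
    rewrite ltnn mul1r mulr0 !addr0 mulr1 => /eqP.
    by rewrite oppr_eq0 => /eqP.
  rewrite mulr0 add0r eqxx; have [->|kn] := eqVneq k n.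
    by rewrite ltnn andbF mulr1 add0r.
  have -> : (1 < k < n)%N by lia.
  by rewrite mulr0 addr0 subn1.
have [kE|kE] : k = n.+1 \/ k = n.+2 by lia.
  have := co0 (n - 1)%N (x n); rewrite br_nn linearD !linearZ /= !coE; try lia.
  have -> : (n - 1 == n)%N = false by lia.
  by rewrite eqxx mulr1 mulr0 addr0 kE.
have := co0 n (x n); rewrite br_nn linearD !linearZ /= !coE; try lia.
have -> : (n == n - 1)%N = false by lia.
by rewrite eqxx mulr1 mulr0 add0r kE.
Qed.

Hypothesis right_n_neq0 : ~ (forall k, (1 <= k <= n.+2)%N -> b k = 0).

Lemma right_n_scale_eq0 s : (forall u, s *: L u (x n) = 0) -> s = 0.
Proof.
by move=> sL; have [//|s0] := eqVneq s 0; case: right_n_neq0;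
  apply: scaled_right_n_eq0 s0 sL.
Qed.

(** The Leibniz identity for y = x_{n-1} and z = x_1: the element [y, z] acts on
    the right as a_n R_{x_n}, whereas R_y = 0. *)
Lemma a_n_eq0 : a n = 0.
Proof.
apply: right_n_scale_eq0 => u.
have := lbracket_leibniz L u (x (n - 1)%N) (x 1%N).
have Lx v : L v (x (n - 1)%N) = 0 by apply: br_ideal; lia.
rewrite br_top !Lx br0l subr0 /A.
rewrite big_nat_recr /=; last by lia.
rewrite brr br_sumr big_nat big1 ?add0r ?brr // => k Hk.
by rewrite brr br_ideal ?scaler0 //; lia.
Qed.

Lemma b_n2_eq0 : b n.+2 = 0.
Proof.
apply: right_n_scale_eq0 => u; have := lbracket_leibniz L u (x n) (x n).
by rewrite subrr br_nn !brr br_ideal ?scaler0 ?add0r //; lia.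
Qed.

Lemma leibniz_n1 u :
  L (L u (x n)) (x 1%N) - L (L u (x 1%N)) (x n)
  = c *: L u (x n) + b 1%N *: L u (x 1%N).
Proof. by rewrite -lbracket_leibniz br_n1 !brr. Qed.

(** Adding the Leibniz identities for (x_n, x_1) and for (x_1, x_n) cancels the
    commutator as well as the multiples of R_{x_1}, and leaves
    (c + b_n) R_{x_n} = 0. *)
Lemma b_n_eq : b n = - c.
Proof.
apply/eqP; rewrite -addr_eq0 addrC; apply/eqP/right_n_scale_eq0 => u.
have := lbracket_leibniz L u (x 1%N) (x n).
rewrite br_in; last by lia.
rewrite !brr br_sumr mul1r big_nat big1 => [|k Hk]; last first.
  by rewrite brr br_ideal ?scaler0 //; lia.
rewrite ?eqxx addr0 -[RHS]opprB leibniz_n1 opprD scaleNr.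
rewrite [X in X = _ -> _]addrC => /addIr Ln.
by rewrite scalerDl Ln subrr.
Qed.

(** [leibniz_n1] at x_i.  The polynomial parts of R_{x_1} R_{x_n} x_i and of
    R_{x_n} R_{x_1} x_i agree, except that in the first one the last term
    b_{n-i} x_{n-1} has been pushed out of the chain and became b_{n-i} A. *)
Lemma chain_coef_eq i k : (1 <= i <= n - 2)%N -> (2 <= k <= n - 1)%N ->
  b (n - i)%N * a k =
  c * ((if i == 1%N then 0 else - (i%:R * b 1%N)) * (k == i)%:R
       + if (i < k)%N then b (k.+1 - i)%N else 0).
Proof.
move=> Hi Hk; have Hi1 : (1 <= i <= n - 1)%N by lia.
have Hk1 : (1 <= k <= n)%N by lia.
have := congr1 (co k) (leibniz_n1 (x i)).
rewrite linearB !linearD !linearZ /= !br_chain // !co_in ?coE //; try lia.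
rewrite br_in // !brl !linearD !linearZ /= br_chain // br_n1.
rewrite linearD !linearZ /=.
rewrite !coE //; try lia.
have -> : co k (L (\sum_(2 <= m < (n - i).+1) b m *: x (m + i - 1)%N) (x 1%N))
    = (if (i.+1 < k < n)%N then b (k.+1 - i.+1)%N else 0) + b (n - i)%N * a k.
  rewrite br_suml big_nat_recr /=; last by lia.
  rewrite linearD brl linearZ /=; congr (_ + _ * _); last first.
    have -> : (n - i + i - 1 = n - 1)%N by lia.
    by rewrite br_top co_A //; have -> : (2 <= k)%N by lia.
  have -> : \sum_(2 <= m < n - i) L (b m *: x (m + i - 1)%N) (x 1%N)
      = \sum_(2 <= m < n - i) b m *: x (m + i.+1 - 1)%N.
    apply: eq_big_nat => m Hm; rewrite brl br_chain; last by lia.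
    by congr (_ *: x _); lia.
  rewrite co_sum //; last by lia.
  by have -> : (2 + i.+1 <= k.+1 < n - i + i.+1)%N = (i.+1 < k < n)%N by lia.
have -> : (if i == 1%N then 0 else - (i%:R * b 1%N)) * (k == i)%:R =
    - (i%:R * b 1%N) * (k == i)%:R.
  case: eqP => // ->; have -> : (k == 1%N) = false by lia.
  by rewrite !mulr0.
have -> : (k == n) = false by lia.
have -> : (k == 1%N) = false by lia.
have -> : (i < k < n)%N = (i < k)%N by lia.
rewrite !(mulr0, addr0) -natr1 => /eqP; rewrite -subr_eq0 => /eqP E.
by apply/eqP; rewrite -subr_eq0 -[X in _ == X]E; apply/eqP; ring.
Qed.

(** [leibniz_n1] at x_{n-1}.  R_{x_n} is triangular on the chain, so the k-th
    coordinate of [A, x_n] reduces to - k b_1 a_k once the previous a_m vanish;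
    this is why the equation is stated with that premise. *)
Lemma top_coef_eq k : (2 <= k <= n - 1)%N ->
  (forall m, (2 <= m < k)%N -> a m = 0) ->
  (n%:R - k%:R) * b 1%N * a k = c * (n - 1)%:R * b 1%N * (k == (n - 1)%N)%:R.
Proof.
move=> Hk a0; have Hk1 : (1 <= k <= n)%N by lia.
have := congr1 (co k) (leibniz_n1 (x (n - 1)%N)).
rewrite br_top br_in; last by lia.
have -> : (n - (n - 1)).+1 = 2 by lia.
have -> : (n - 1 == 1)%N = false by lia.
rewrite big_geq // scale0r !addr0 brl br_top.
rewrite linearB linearD !linearZ /= co_A // coE //; last by lia.
have -> : (2 <= k)%N by lia.
have -> : co k (L A (x n)) = - (k%:R * b 1%N) * a k.
  rewrite br_suml linear_sum /= big_nat_recr /= ?a_n_eq0; last by lia.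
  rewrite scale0r br0l linear0 addr0.
  have cE m : (2 <= m < n)%N -> co k (L (a m *: x m) (x n)) =
      if m == k then - (k%:R * b 1%N) * a k else 0.
    move=> Hm; rewrite brl linearZ /= co_in //; last by lia.
    have -> : (k == n) = false by lia.
    have [mk|km|<-] := ltngtP m k.
    - by rewrite a0 ?mul0r //; lia.
    - by rewrite !mulr0 !addr0 mulr0.
    by rewrite mulr0 !addr0 mulr1 mulrC.
  rewrite (eq_big_nat _ _ cE) -big_mkcond /= big_nat1_eq.
  by have -> : (2 <= k < n)%N by lia.
rewrite natrB; last by lia.
move/eqP; rewrite -subr_eq0 => /eqP E.
by apply/eqP; rewrite -subr_eq0 -oppr_eq0 -[X in _ == X]E; apply/eqP; ring.
Qed.

(** [leibniz_n1] at x_n. *)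
Lemma last_coef_eq k : (2 <= k <= n - 1)%N ->
  b n.+1 * a k - b 1%N * b k = 2%:R * c * b n.+1 * (k == (n - 1)%N)%:R.
Proof.
move=> Hk; have Hk1 : (1 <= k <= n)%N by lia.
have := congr1 (co k) (leibniz_n1 (x n)).
rewrite br_nn br_n1 b_n2_eq0 scale0r addr0 !brl br_top br_nn.
rewrite b_n2_eq0 scale0r addr0 linearB !linearD !linearZ /= co_A //.
rewrite !coE ?co_in //; try lia.
have -> : (2 <= k)%N by lia.
have -> : (k == n) = false by lia.
have -> : (k == 1%N) = false by lia.
have -> : (k < n)%N by lia.
have -> : (k.+1 - 1 = k)%N by lia.
rewrite /= !(mulr0, addr0) => /eqP; rewrite -subr_eq0 => /eqP E.
by apply/eqP; rewrite -subr_eq0 -[X in _ == X]E; apply/eqP; ring.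
Qed.

(** For b_1 non-zero, [top_coef_eq] kills a_2, ..., a_{n-2} one after the other,
    in characteristic 0.  The index i = k = n - 2 of [chain_coef_eq] then gives
    c = 0, which in turn kills a_{n-1} and, through [last_coef_eq], the b_k. *)
Lemma coefs_b1_neq0 : [pchar K] =i pred0 -> b 1%N != 0 ->
  [/\ c = 0, forall k, (2 <= k <= n)%N -> a k = 0
    & forall k, (2 <= k <= n)%N -> b k = 0].
Proof.
move=> /pcharf0P K0 b1.
have a0 k : (2 <= k <= n - 2)%N -> a k = 0.
  elim/ltn_ind: k => k IH Hk; have Hk1 : (2 <= k <= n - 1)%N by lia.
  have am m : (2 <= m < k)%N -> a m = 0 by move=> Hm; apply: IH; lia.
  move: (top_coef_eq Hk1 am); have -> : (k == (n - 1)%N) = false by lia.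
  rewrite mulr0 -natrB; last by lia.
  move/eqP; rewrite !mulf_eq0 (negPf b1) K0 orbF.
  have -> /= : (n - k == 0)%N = false by lia.
  by move/eqP.
have c0 : c = 0.
  have Hi : (1 <= n - 2 <= n - 2)%N by lia.
  have Hk : (2 <= n - 2 <= n - 1)%N by lia.
  move: (chain_coef_eq Hi Hk); rewrite a0; last by lia.
  rewrite ltnn eqxx (_ : (n - 2 == 1)%N = false); last by lia.
  rewrite mulr0 addr0 mulr1 => /esym/eqP.
  rewrite mulf_eq0 oppr_eq0 mulf_eq0 (negPf b1) K0 orbF.
  by rewrite (_ : (n - 2 == 0)%N = false) ?orbF; [move/eqP | lia].
have a0' k : (2 <= k <= n)%N -> a k = 0.
  move=> Hk; have [->|kn] := eqVneq k n; first exact: a_n_eq0.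
  have [lek|ltk] := leqP k (n - 2); first by rewrite a0 //; lia.
  have -> : k = (n - 1)%N by lia.
  have Hk1 : (2 <= n - 1 <= n - 1)%N by lia.
  have am m : (2 <= m < n - 1)%N -> a m = 0 by move=> Hm; apply: a0; lia.
  have := top_coef_eq Hk1 am.
  rewrite c0 !mul0r -natrB; last by lia.
  move/eqP; rewrite !mulf_eq0 (negPf b1) K0 orbF.
  by rewrite (_ : (n - (n - 1) == 0)%N = false) /=; [move/eqP | lia].
split=> // k Hk; have [->|kn] := eqVneq k n; first by rewrite b_n_eq c0 oppr0.
have Hk1 : (2 <= k <= n - 1)%N by lia.
have /eqP := last_coef_eq Hk1; rewrite a0' // c0 !(mulr0, mul0r) sub0r.
by rewrite oppr_eq0 mulf_eq0 (negPf b1) => /eqP.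
Qed.

(** The case i = 1 of [chain_coef_eq] is the one without a shift of indices: it
    relates A to the whole polynomial part of R_{x_n}. *)
Lemma coefs_first_chain k : (2 <= k <= n - 1)%N -> b (n - 1)%N * a k = c * b k.
Proof.
move=> Hk; have H1 : (1 <= 1 <= n - 2)%N by lia.
have := chain_coef_eq H1 Hk; rewrite eqxx mul0r add0r.
by have [-> ->] : (1 < k)%N /\ (k.+1 - 1 = k)%N by lia.
Qed.

(** By [coefs_first_chain], a_k and b_k vanish together for 2 <= k <= n - 1.  If
    k <= n - 2 is the first index at which they do not vanish, then
    [chain_coef_eq] at i = n - k gives b_k a_k = 0: its right-hand side is 0
    if 2k <= n, and otherwise a multiple of b_{2k+1-n}, whose index is smaller
    than k. *)
Lemma coefs_b_top_neq0 : b 1%N = 0 -> c != 0 -> b (n - 1)%N != 0 ->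
  [/\ a (n - 1)%N = c, forall k, (2 <= k <= n - 2)%N -> a k = 0,
      forall k, (2 <= k <= n - 2)%N -> b k = 0 & b n.+1 = 0].
Proof.
move=> b1 c0 bt; have Ht : (2 <= n - 1 <= n - 1)%N by lia.
have at_c : a (n - 1)%N = c.
  by apply: (mulfI bt); rewrite coefs_first_chain // mulrC.
have ab k : (2 <= k <= n - 1)%N -> a k = 0 -> b k = 0.
  move=> Hk ak; have /esym/eqP := coefs_first_chain Hk.
  by rewrite ak mulr0 mulf_eq0 (negPf c0) => /eqP.
have a0 k : (2 <= k <= n - 2)%N -> a k = 0.
  elim/ltn_ind: k => k IH Hk; have Hk1 : (2 <= k <= n - 1)%N by lia.
  have Hi : (1 <= n - k <= n - 2)%N by lia.
  have := chain_coef_eq Hi Hk1.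
  have -> : (n - (n - k) = k)%N by lia.
  rewrite b1 mulr0 oppr0 if_same mul0r add0r => E.
  have {E} : b k * a k = 0.
    rewrite E; case: ifP => Hlt; last by rewrite mulr0.
    by rewrite ab ?mulr0 ?IH //; lia.
  move/eqP; rewrite mulf_eq0 => /orP[/eqP bk|/eqP //].
  have /eqP := coefs_first_chain Hk1.
  by rewrite bk mulr0 mulf_eq0 (negPf bt) => /eqP.
split=> // [k Hk|]; first by rewrite ab ?a0 //; lia.
have /eqP := last_coef_eq Ht; rewrite b1 mul0r subr0 at_c eqxx mulr1.
rewrite -subr_eq0 (_ : _ - _ = - (c * b n.+1)); last by ring.
by rewrite oppr_eq0 mulf_eq0 (negPf c0) => /eqP.
Qed.

Lemma coefs_b_top_eq0 : b 1%N = 0 -> c != 0 -> b (n - 1)%N = 0 ->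
  (forall k, (2 <= k <= n - 1)%N -> b k = 0) /\
  (b n.+1 != 0 ->
   a (n - 1)%N = 2%:R * c /\ forall k, (2 <= k <= n - 2)%N -> a k = 0).
Proof.
move=> b1 c0 bt; split=> [k Hk|bn1].
  have /esym/eqP := coefs_first_chain Hk.
  by rewrite bt mul0r mulf_eq0 (negPf c0) => /eqP.
split=> [|k Hk].
  have Ht : (2 <= n - 1 <= n - 1)%N by lia.
  have := last_coef_eq Ht; rewrite b1 mul0r subr0 eqxx mulr1 => E.
  by apply: (mulfI bn1); rewrite E mulrC.
have Hk1 : (2 <= k <= n - 1)%N by lia.
have /eqP := last_coef_eq Hk1; rewrite b1 mul0r subr0.
have -> : (k == (n - 1)%N) = false by lia.
by rewrite mulr0 mulf_eq0 (negPf bn1) => /eqP.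
Qed.

(** Here the equations read b_m a_k = 0 for all m, and some b_m is non-zero. *)
Lemma coefs_b1_c_eq0 : b 1%N = 0 -> c = 0 ->
  b n = 0 /\ forall k, (2 <= k <= n)%N -> a k = 0.
Proof.
move=> b1 c0; have bn : b n = 0 by rewrite b_n_eq c0 oppr0.
split=> // k Hk; have [->|kn] := eqVneq k n; first exact: a_n_eq0.
have Hk1 : (2 <= k <= n - 1)%N by lia.
have [//|ak] := eqVneq (a k) 0; case: right_n_neq0 => m Hm.
have [m1|[mn|[mn1|[mn2|Hm']]]] : m = 1%N \/ m = n \/ m = n.+1 \/ m = n.+2
  \/ (2 <= m <= n - 1)%N by lia.
- by rewrite m1.
- by rewrite mn.
- rewrite mn1; have /eqP := last_coef_eq Hk1.
  by rewrite b1 c0 mul0r subr0 mulr0 !mul0r mulf_eq0 (negPf ak) orbF => /eqP.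
- by rewrite mn2 b_n2_eq0.
have Hi : (1 <= n - m <= n - 2)%N by lia.
have /eqP := chain_coef_eq Hi Hk1.
have -> : (n - (n - m) = m)%N by lia.
by rewrite c0 mul0r mulf_eq0 (negPf ak) orbF => /eqP.
Qed.

End LeibnizEquations.

(** * Normal forms nu_2 to nu_5 and F_2 *)

Lemma local_nu2 : local_table V n (nu2_mtable K n).
Proof.
move=> y z exy i j Hi Hj; rewrite /nu2_mtable.
by case: ifP => [E|_]; last case: ifP => [E|_]; last case: ifP => [E|//];
  rewrite exy //; lia.
Qed.

(** As R_{x_{n-1}} = 0, adding a multiple of x_{n-1} to x_n changes neither
    R_{x_n} nor [x_n, x_1]; since R_{x_n} has the eigenvalue - (n-1) b_1 at
    x_{n-1}, a suitable multiple makes the square of x_n vanish. *)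
Lemma nu2_normal_form : (n - 1)%:R != 0 :> K -> b 1%N != 0 -> c = 0 ->
  (forall k, (2 <= k <= n)%N -> a k = 0) ->
  (forall k, (2 <= k <= n)%N -> b k = 0) -> b n.+2 = 0 ->
  has_mtable n L (nu2_mtable K n).
Proof.
move=> n1 b1 c0 a0 b0 bn2.
pose e := b n.+1 / (b 1%N ^+ 2 * (n - 1)%:R).
pose y k := if k == n then (b 1%N)^-1 *: x n + e *: x (n - 1)%N else x k.
have yE k : (k < n)%N -> y k = x k by move=> lt; rewrite /y ltn_eqF.
have y_n : y n = (b 1%N)^-1 *: x n + e *: x (n - 1)%N by rewrite /y eqxx.
have A0 : L (x (n - 1)%N) (x 1%N) = 0.
  by rewrite br_top /A big_nat big1 // => k Hk; rewrite a0 ?scale0r //; lia.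
have Lxn i : (1 <= i <= n - 1)%N -> L (x i) (x n) = - (i%:R * b 1%N) *: x i.
  move=> Hi; rewrite br_in // (b0 n); last by lia.
  rewrite if_same scale0r addr0 big_nat big1 ?addr0 // => k Hk.
  by rewrite b0 ?scale0r //; lia.
apply: (has_mtableI (x := y)) => //.
- apply: (family_span_full spanx) => k Hk.
  have [->|kn] := eqVneq k n; last first.
    by rewrite -yE ?mem_family_span //; lia.
  have -> : x n = b 1%N *: (y n - e *: y (n - 1)%N).
    by rewrite y_n yE ?addrK ?scalerA ?divff ?scale1r //; lia.
  by apply: memvZ; apply: memvB; [|apply: memvZ]; apply: mem_family_span; lia.
- exact: local_nu2.
move=> i j Hi Hj; rewrite /nu2_mtable.
have [->|j1] := eqVneq j 1%N.
  rewrite (yE 1%N); last by lia.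
  have -> : (1%N == n) = false by lia.
  have [->|ni] := eqVneq i n.
    have -> : (1 <= n <= n - 2)%N = false by lia.
    rewrite /= y_n !brl br_n1 A0 c0 scale0r add0r scaler0 addr0.
    by rewrite scalerA mulVf ?scale1r.
  rewrite yE; last by lia.
  have [->|ni'] := eqVneq i (n - 1)%N.
    have -> : (1 <= n - 1 <= n - 2)%N = false by lia.
    by rewrite A0.
  have -> /= : (1 <= i <= n - 2)%N by lia.
  by rewrite br_chain ?yE //; lia.
rewrite andbF /=; have [->|jn] := eqVneq j n; last first.
  by rewrite (yE j) ?br_ideal //; lia.
have Lx u : L u (x (n - 1)%N) = 0 by apply: br_ideal; lia.
rewrite y_n !brr Lx scaler0 addr0.
have [->|ni] := eqVneq i n.
  have -> : (1 <= n <= n - 1)%N = false by lia.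
  rewrite /= y_n !brl br_nn Lxn ?bn2 ?scale0r ?addr0 ?scalerA; last by lia.
  rewrite -scalerDl scalerA [X in X *: _](_ : _ = 0) ?scale0r // /e.
  by field; rewrite n1 b1.
have -> /= : (1 <= i <= n - 1)%N by lia.
rewrite yE ?Lxn ?scalerA; try lia.
by congr (_ *: _); field.
Qed.

Lemma sum_scale_delta (W : lmodType K) (F : nat -> W) p q m (s : K) :
  \sum_(p <= k < q) (if k == m then s else 0) *: F k =
  if (p <= m < q)%N then s *: F m else 0.
Proof.
transitivity (\sum_(p <= k < q | k == m) s *: F k); last exact: big_nat1_eq.
by rewrite [RHS]big_mkcond; apply: eq_bigr => k _; case: eqP; rewrite ?scale0r.
Qed.

(** Only b_{n-1} survives, so the vector (b_2, ..., b_{n-1}) of nu_3 is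
    (0, ..., 0, 1): x_1 is rescaled to make c equal to -1, and x_n to make
    b_{n-1} equal to 1. *)
Lemma nu3_normal_form : c != 0 -> b (n - 1)%N != 0 -> b 1%N = 0 -> b n = - c ->
  a n = 0 -> a (n - 1)%N = c -> (forall k, (2 <= k <= n - 2)%N -> a k = 0) ->
  (forall k, (2 <= k <= n - 2)%N -> b k = 0) -> b n.+1 = 0 -> b n.+2 = 0 ->
  exists2 b', first_nonzero_eq1 K n b' & has_mtable n L (nu3_mtable K n b').
Proof.
move=> c0 bt b1 bn an at_c a0 b0 bn1 bn2.
pose s := - c^-1; have s0 : s != 0 by rewrite oppr_eq0 invr_eq0.
have sc : s * c = -1 by rewrite mulNr mulVf.
pose t := s ^+ (n - 2) / b (n - 1)%N.
have t0 : t != 0 by rewrite mulf_neq0 ?invr_eq0 ?expf_neq0.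
exists (fun k => if k == (n - 1)%N then 1 else 0) => [k Hk + _|].
  by case: ifP => //; rewrite eqxx.
have: has_mtable n L (deform_mtable K n
   (fun k => if k == (n - 1)%N then -1 else 0)
   (fun k => if (k == n - 1)%N || (k == n) then 1 else 0) (-1)).
  apply: deform_coef_eq (deform_scale s0 t0) => [k Hk|k Hk|//].
    have [->|kn] := eqVneq k n.
      have -> : (n == n - 1)%N = false by lia.
      by rewrite an mulr0.
    have [->|kn1] := eqVneq k (n - 1)%N; last by rewrite a0 ?mulr0 //; lia.
    have -> : (n - (n - 1) = 1)%N by lia.
    by rewrite expr1 at_c sc.
  have [->|kn] := eqVneq k n; first by rewrite orbT bn mulrN sc opprK.
  rewrite orbF; have [->|kn'] := eqVneq k n.+1.
    have -> : (n.+1 == n - 1)%N = false by lia.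
    by rewrite bn1 mulr0.
  have [->|kn''] := eqVneq k n.+2.
    have -> : (n.+2 == n - 1)%N = false by lia.
    by rewrite bn2 mulr0.
  have [->|kt] := eqVneq k (n - 1)%N.
    have -> : s ^+ (n - 1) = s ^+ (n - 2) * s.
      by rewrite -exprSr; congr (_ ^+ _); lia.
    by rewrite /t; field; rewrite ?bt ?s0 ?expf_neq0.
  have [->|k1] := eqVneq k 1%N; first by rewrite b1 mulr0.
  by rewrite b0 ?mulr0 //; lia.
apply: has_mtable_eq => y i j Hi Hj; rewrite /deform_mtable /nu3_mtable.
have [_|j1] := eqVneq j 1%N.
  have [->|ni] := eqVneq i n.
    have -> : (n <= n - 2)%N = false by lia.
    have -> : (n == n - 1)%N = false by lia.
    have -> : (1 == n - 1)%N = false by lia.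
    have -> : (1 == n)%N = false by lia.
    by rewrite !andbF /= scaleN1r scale0r addr0.
  have [->|ni'] := eqVneq i (n - 1)%N.
    have -> : (n - 1 <= n - 2)%N = false by lia.
    rewrite sum_scale_delta.
    have -> : (2 <= n - 1 < n.+1)%N by lia.
    by rewrite andbF /= scaleN1r.
  by have -> : (1 <= i <= n - 2)%N by lia.
rewrite /= !andbF; have [_|jn] := eqVneq j n; last by rewrite andbF.
have [->|ni] := eqVneq i n.
  have -> : (n.+1 == n - 1)%N = false by lia.
  have -> : (n.+2 == n - 1)%N = false by lia.
  have -> : (n.+1 == n)%N = false by lia.
  have -> : (n.+2 == n)%N = false by lia.
  have -> : (n == 1)%N = false by lia.
  have -> : (n <= n - 2)%N = false by lia.
  by rewrite !scale0r addr0 !andbF.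
have -> : (1 == n - 1)%N = false by lia.
have -> : (1 == n)%N = false by lia.
rewrite mulr0 oppr0 scale0r add0r eqxx orbT.
have -> : \sum_(2 <= k < (n - i).+1)
      (if (k == n - 1)%N || (k == n) then 1 else 0) *: y (k + i - 1)%N =
    \sum_(2 <= k < (n - i).+1)
      (if (k == n - 1)%N then 1 else 0) *: y (k + i - 1)%N.
  apply: eq_big_nat => k Hk; have -> : (k == n) = false by lia.
  by rewrite orbF.
have [->|i1] := eqVneq i 1%N.
  rewrite scale1r addrC; congr (_ + _).
  have -> : (n - 1).+1 = n by lia.
  by apply: eq_bigr => k _; rewrite addnK.
rewrite scale0r addr0 /=; case: ifP => // Hi2.
by rewrite big_geq //; lia.
Qed.

(** After c has been rescaled to -1, only x_n can still be multiplied by a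
    scalar t, and [x_n, x_n] = b_{n+1} x_{n-1} is then multiplied by t^2: this
    is where a square root is needed. *)
Lemma nu4_normal_form : (forall z : K, exists t, t ^+ 2 = z) ->
  c != 0 -> b n.+1 != 0 -> b n = - c -> a n = 0 -> a (n - 1)%N = 2%:R * c ->
  (forall k, (2 <= k <= n - 2)%N -> a k = 0) ->
  (forall k, (1 <= k <= n - 1)%N -> b k = 0) -> b n.+2 = 0 ->
  has_mtable n L (nu4_mtable K n).
Proof.
move=> sqrtK c0 bt bn an at_c a0 b0 bn2.
pose s := - c^-1; have s0 : s != 0 by rewrite oppr_eq0 invr_eq0.
have sc : s * c = -1 by rewrite mulNr mulVf.
have [t t2] := sqrtK (s ^+ (n - 1) / b n.+1).
have t0 : t != 0.
  by rewrite -sqrf_eq0 t2 mulf_neq0 ?invr_eq0 ?expf_neq0.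
have: has_mtable n L (deform_mtable K n
   (fun k => if k == (n - 1)%N then - 2%:R else 0)
   (fun k => if (k == n) || (k == n.+1) then 1 else 0) (-1)).
  apply: deform_coef_eq (deform_scale s0 t0) => [k Hk|k Hk|//].
    have [->|kn] := eqVneq k n.
      have -> : (n == n - 1)%N = false by lia.
      by rewrite an mulr0.
    have [->|kn1] := eqVneq k (n - 1)%N; last by rewrite a0 ?mulr0 //; lia.
    have -> : (n - (n - 1) = 1)%N by lia.
    by rewrite expr1 at_c mulrCA sc mulrN1.
  have [_|kn] := eqVneq k n; first by rewrite bn mulrN sc opprK.
  have [_|kn'] := eqVneq k n.+1.
    by rewrite t2; field; rewrite ?bt ?s0 ?expf_neq0.
  have [_|kn''] := eqVneq k n.+2; first by rewrite bn2 mulr0.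
  by rewrite b0 ?mulr0 //; lia.
apply: has_mtable_eq => y i j Hi Hj; rewrite /deform_mtable /nu4_mtable.
have [_|j1] := eqVneq j 1%N.
  have [->|ni] := eqVneq i n.
    have -> : (n <= n - 2)%N = false by lia.
    have -> : (n == n - 1)%N = false by lia.
    have -> : (1 == n.+1)%N = false by lia.
    have -> : (1 == n)%N = false by lia.
    by rewrite !andbF /= scaleN1r scale0r addr0.
  have [->|ni'] := eqVneq i (n - 1)%N.
    have -> : (n - 1 <= n - 2)%N = false by lia.
    rewrite sum_scale_delta.
    have -> : (2 <= n - 1 < n.+1)%N by lia.
    by rewrite andbF.
  by have -> : (1 <= i <= n - 2)%N by lia.
rewrite /= !andbF; have [_|jn] := eqVneq j n; last by rewrite !andbF.
have [->|ni] := eqVneq i n.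
  have -> : (n.+2 == n.+1)%N = false by lia.
  have -> : (n.+2 == n)%N = false by lia.
  have -> : (n == 1)%N = false by lia.
  by rewrite eqxx orbT scale1r scale0r addr0.
have -> : (1 == n.+1)%N = false by lia.
have -> : (1 == n)%N = false by lia.
rewrite mulr0 oppr0 scale0r add0r eqxx big_nat big1 ?add0r => [|k Hk].
  by case: eqP => _; rewrite ?scale1r ?scale0r.
have -> : (k == n) = false by lia.
have -> : (k == n.+1) = false by lia.
by rewrite scale0r.
Qed.

Lemma nu5_normal_form : c != 0 -> b n = - c -> a n = 0 ->
  (forall k, (1 <= k <= n.+2)%N -> k != n -> b k = 0) ->
  exists a', has_mtable n L (nu5_mtable K n a').
Proof.
move=> c0 bn an b0.
pose s := - c^-1; have s0 : s != 0 by rewrite oppr_eq0 invr_eq0.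
have sc : s * c = -1 by rewrite mulNr mulVf.
exists (fun k => s ^+ (n - k) * a k).
have: has_mtable n L (deform_mtable K n
    (fun k => if k == n then 0 else s ^+ (n - k) * a k)
    (fun k => if k == n then 1 else 0) (-1)).
  apply: deform_coef_eq (deform_scale s0 (oner_neq0 K)) => [k Hk|k Hk|//].
    by case: eqP => // _; rewrite an mulr0.
  have [_|kn] := eqVneq k n; first by rewrite bn mulrN sc opprK.
  have [_|kn'] := eqVneq k n.+1; first by rewrite b0 ?mulr0 //; lia.
  have [_|kn''] := eqVneq k n.+2; first by rewrite b0 ?mulr0 //; lia.
  by rewrite b0 ?mulr0.
apply: has_mtable_eq => y i j Hi Hj; rewrite /deform_mtable /nu5_mtable.
have -> : (1 == n)%N = false by lia.
have [_|j1] := eqVneq j 1%N.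
  have [->|ni] := eqVneq i n.
    have -> : (n <= n - 2)%N = false by lia.
    have -> : (n == n - 1)%N = false by lia.
    by rewrite !andbF /= scaleN1r scale0r addr0.
  have [->|ni'] := eqVneq i (n - 1)%N.
    have -> : (n - 1 <= n - 2)%N = false by lia.
    rewrite big_nat_recr /=; last by lia.
    rewrite eqxx scale0r addr0 andbF; apply: eq_big_nat => k Hk.
    by have -> : (k == n) = false by lia.
  by have -> : (1 <= i <= n - 2)%N by lia.
rewrite /= !andbF; have [_|jn] := eqVneq j n; last by rewrite andbF.
have [->|ni] := eqVneq i n.
  have -> : (n.+2 == n)%N = false by lia.
  have -> : (n.+1 == n)%N = false by lia.
  have -> : (n == 1)%N = false by lia.
  by rewrite !scale0r addr0.
rewrite mulr0 oppr0 scale0r add0r eqxx big_nat big1 ?add0r => [|k Hk].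
  by case: eqP => _; rewrite ?scale1r ?scale0r.
have -> : (k == n) = false by lia.
by rewrite scale0r.
Qed.

Lemma F2_normal_form : c = 0 -> (forall k, (2 <= k <= n)%N -> a k = 0) ->
  b 1%N = 0 -> b 2%N = 0 -> b n = 0 -> b n.+2 = 0 ->
  exists beta gamma, has_mtable n L (F2_mtable K n beta gamma).
Proof.
move=> c0 a0 b1 b2 bn bn2; exists b, (b n.+1).
apply: has_mtable_eq has_deform => y i j Hi Hj.
rewrite /deform_mtable /F2_mtable b1 bn bn2 c0 !scale0r !addr0 mulr0 oppr0.
rewrite if_same !scale0r addr0 add0r.
have [->|j1] := eqVneq j 1%N.
  have -> : (1%N == n) = false by lia.
  have [->|ni] := eqVneq i n.
    have -> : (n <= n - 2)%N = false by lia.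
    have -> : (n <= n - 3)%N = false by lia.
    by rewrite !andbF.
  have [->|ni'] := eqVneq i (n - 1)%N; last first.
    by have -> : (1 <= i <= n - 2)%N by lia.
  have -> : (n - 1 <= n - 2)%N = false by lia.
  have -> : (n - 1 <= n - 3)%N = false by lia.
  rewrite !andbF /= big_nat big1 // => k Hk.
  by rewrite a0 ?scale0r.
rewrite /=; have [_|jn] := eqVneq j n; last by rewrite andbF.
have [->|ni] := eqVneq i n.
  have -> : (n <= n - 3)%N = false by lia.
  by rewrite andbF.
have [len|ltn] := leqP i (n - 2); last first.
  have -> : (i <= n - 3)%N = false by lia.
  by rewrite big_geq ?andbF //; lia.
rewrite big_ltn ?b2 ?scale0r ?add0r; last by lia.
have [->|ni2] := eqVneq i (n - 2)%N.
  have -> : (n - 2 <= n - 3)%N = false by lia.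
  by rewrite big_geq ?andbF //; lia.
have -> /= : (1 <= i <= n - 3)%N by lia.
by apply: eq_bigr => k _; rewrite addnC.
Qed.

(** * Normal form F_1 *)

Lemma local_F1 theta alpha : local_table V n (F1_mtable K n theta alpha).
Proof.
move=> y z exy i j Hi Hj; rewrite /F1_mtable.
case: ifP => [E|_]; first by rewrite exy //; lia.
case: ifP => [E|_]; first by rewrite exy //; lia.
case: ifP => // E; apply: eq_big_nat => k Hk; rewrite exy //; lia.
Qed.

Lemma bracket_span_l (X : seq V) (U : {vspace V}) w :
  (forall u, u \in X -> L u w \in U) -> forall v, v \in <<X>>%VS -> L v w \in U.
Proof.
move=> XU v; rewrite -[X]/(tval (in_tuple X)) => /coord_span ->.
rewrite br_suml memv_suml // => i _; rewrite brl memvZ // XU //.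
by rewrite mem_nth.
Qed.

Lemma bracket_span_r (X : seq V) w :
  (forall u, u \in X -> L w u = 0) -> forall v, v \in <<X>>%VS -> L w v = 0.
Proof.
move=> X0 v; rewrite -[X]/(tval (in_tuple X)) => /coord_span ->.
rewrite br_sumr big1 // => i _; rewrite brr X0 ?scaler0 //.
by rewrite mem_nth.
Qed.

(** The filtration of the chain; R_{x_n} is triangular with respect to it. *)
Definition chain_tail k : {vspace V} := <<[seq x m | m <- index_iota k n]>>%VS.

Lemma mem_chain_tail k m : (k <= m < n)%N -> x m \in chain_tail k.
Proof. by move=> Hm; rewrite memv_span // map_f // mem_index_iota. Qed.

Lemma chain_tailE k :
  (k < n)%N -> chain_tail k = (<[x k]> + chain_tail k.+1)%VS.
Proof.
by move=> ltk; rewrite /chain_tail /index_iota -(subnSK ltk) /= span_cons.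
Qed.

Lemma chain_tail_sub k l : (k <= l)%N -> (chain_tail l <= chain_tail k)%VS.
Proof.
move=> lekl; apply/span_subvP => _ /mapP[m + ->].
by rewrite mem_index_iota => Hm; rewrite mem_chain_tail //; lia.
Qed.

Lemma chain_tail_eq0 : chain_tail n = 0%VS.
Proof. by rewrite /chain_tail /index_iota subnn span_nil. Qed.

(** When b_2 is non-zero, N' = R_{x_n} shifts the chain up to higher terms,
    while x_1 - x_n / b_2 acts on it with order at least two. So the new y_1
    is x_n, corrected by a multiple of x_{n-2} to have square zero, the new
    y_2 is x_1 - x_n / b_2, and y_k = N'^(k-2) y_2. The vectors y_3, ...,
    y_n are triangular over x_2, ..., x_{n-1}, which makes [y_2, y_2] a
    combination of y_4, ..., y_n. As R_{y_2} commutes with N', applying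
    N'^(j-2) to this combination gives [y_j, y_2]: the coefficients are the
    same alpha_k. *)
Lemma F1_normal_form : c = 0 -> (forall k, (2 <= k <= n)%N -> a k = 0) ->
  b 1%N = 0 -> b n = 0 -> b n.+2 = 0 -> b 2%N != 0 ->
  exists theta alpha, has_mtable n L (F1_mtable K n theta alpha).
Proof.
move=> c0 a0 b1 bn bn2 b2.
pose rn u := L u (x n).
have rn_x k : (1 <= k <= n - 1)%N ->
    rn (x k) = \sum_(2 <= m < (n - k).+1) b m *: x (m + k - 1)%N.
  move=> Hk; rewrite /rn br_in // b1 bn if_same mulr0 oppr0.
  by rewrite !scale0r addr0 add0r.
have rn_xn : rn (x n) = b n.+1 *: x (n - 1)%N.
  by rewrite /rn br_nn bn2 scale0r addr0.
have rn_lead k :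
    (1 <= k <= n - 2)%N -> rn (x k) - b 2%N *: x k.+1 \in chain_tail k.+2.
  move=> Hk; rewrite rn_x; last by lia.
  rewrite big_ltn; last by lia.
  have -> : (2 + k - 1 = k.+1)%N by lia.
  rewrite addrC addKr.
  rewrite big_nat memv_suml // => m Hm.
  by rewrite memvZ // mem_chain_tail //; lia.
have rn_top : rn (x (n - 1)%N) = 0 by rewrite rn_x ?big_geq //; lia.
have rn_tail k v : (1 <= k)%N -> v \in chain_tail k -> rn v \in chain_tail k.+1.
  move=> Hk; apply: bracket_span_l => _ /mapP[m + ->].
  rewrite mem_index_iota => Hm; have [->|nm] := eqVneq m (n - 1)%N.
    by rewrite -/(rn _) rn_top mem0v.
  rewrite -[L _ _](subrK (b 2%N *: x m.+1)).
  rewrite memvD ?memvZ ?mem_chain_tail //; last by lia.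
  have /subvP tm : (chain_tail m.+2 <= chain_tail k.+1)%VS.
    by apply: chain_tail_sub; lia.
  by apply/tm/rn_lead; lia.
pose z k := iter (k - 2) rn (x 1%N - (b 2%N)^-1 *: x n).
have zS k : (2 <= k)%N -> z k.+1 = rn (z k).
  by move=> Hk; rewrite /z subSn.
have z_lead k :
    (3 <= k <= n)%N -> z k - b 2%N ^+ (k - 2) *: x (k - 1)%N \in chain_tail k.
  elim: k => // k IH Hk; have [->|k2] := eqVneq k 2.
    rewrite zS // /z /= /rn !brl -/(rn _) -/(rn _) rn_xn expr1 addrAC memvD //.
      by apply: rn_lead; lia.
    by rewrite -scaleNr scalerA memvZ // mem_chain_tail //; lia.
  have {}IH : z k - b 2%N ^+ (k - 2) *: x (k - 1)%N \in chain_tail k.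
    by apply: IH; lia.
  rewrite zS; last by lia.
  have -> : (k.+1 - 2)%N = (k - 2).+1 by lia.
  rewrite -[z k](subrK (b 2%N ^+ (k - 2) *: x (k - 1)%N)) /rn brDl -addrA.
  rewrite memvD //; first by apply: rn_tail; rewrite ?IH //; lia.
  rewrite brl exprSr -scalerA -scalerBr memvZ //.
  have H1 : (1 <= k - 1 <= n - 2)%N by lia.
  have := rn_lead _ H1.
  have -> : (k - 1).+2 = k.+1 by lia.
  by have -> : (k - 1).+1 = (k.+1 - 1)%N by lia.
have z_n : z n = b 2%N ^+ (n - 2) *: x (n - 1)%N.
  apply/eqP; rewrite -subr_eq0 -memv0 -chain_tail_eq0; apply: z_lead; lia.
have z_out k : (n < k)%N -> z k = 0.
  elim: k => // k IH; rewrite ltnS leq_eqVlt => /predU1P[<-|ltk].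
    by rewrite zS /rn ?z_n ?brl -/(rn _) ?rn_top ?scaler0 //; lia.
  by rewrite zS /rn ?IH ?br0l //; lia.
(* Inversion of the triangular system: the chain vectors are combinations of
   the z_m, by descending induction along the filtration. *)
have tail_z k v : (2 <= k <= n)%N -> v \in chain_tail k ->
    exists al : nat -> K, v = \sum_(k.+1 <= m < n.+1) al m *: z m.
  move Ed : (n - k)%N => d; elim: d k v Ed => [|d IH] k v Ed Hk.
    have -> : k = n by lia.
    rewrite chain_tail_eq0 memv0 => /eqP->; exists (fun=> 0).
    by rewrite big_geq.
  have ltk : (k < n)%N by lia.
  rewrite chain_tailE // => /memv_addP[_ /vlineP[s ->] [v' v'T ->]].
  pose e := s / b 2%N ^+ (k - 1).
  have Hk3 : (3 <= k.+1 <= n)%N by lia.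
  have := z_lead _ Hk3.
  have [-> ->] : (k.+1 - 2 = k - 1)%N /\ (k.+1 - 1 = k)%N by lia.
  set w := z k.+1 - _ => wT.
  have [|||al alE] := IH k.+1 (v' - e *: w); try lia.
    by rewrite memvB // memvZ.
  exists (fun m => if m == k.+1 then e else al m).
  rewrite big_ltn ?eqxx; last by lia.
  have -> : \sum_(k.+2 <= m < n.+1) (if m == k.+1 then e else al m) *: z m
      = \sum_(k.+2 <= m < n.+1) al m *: z m.
    by apply: eq_big_nat => m Hm; have -> : (m == k.+1) = false by lia.
  rewrite -alE /w scalerBr opprB scalerA /e divfK ?expf_neq0 //.
  by rewrite [LHS]addrC [RHS]addrCA; congr (_ + _); rewrite addrC subrK.
have L_tail u v : v \in chain_tail 2 -> L u v = 0.
  apply: bracket_span_r => _ /mapP[m + ->]; rewrite mem_index_iota => Hm.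
  by apply: br_ideal; lia.
(* The correction of x_n for which [x_n + w, x_n + w] = 0. *)
pose w := - (b n.+1 / b 2%N) *: x (n - 2)%N.
pose y k := if k == 1%N then x n + w else z k.
have y1 : y 1%N = x n + w by [].
have yz k : (2 <= k)%N -> y k = z k by case: k => [|[]].
have y2 : y 2 = x 1%N - (b 2%N)^-1 *: x n by rewrite yz.
have ideal_n2 u : L u (x (n - 2)%N) = 0 by apply: br_ideal; lia.
have Ly1 u : L u (y 1%N) = rn u by rewrite y1 !brr ideal_n2 scaler0 addr0.
have Ly2 u : L u (y 2) = L u (x 1%N) - (b 2%N)^-1 *: rn u by rewrite y2 !brr.
have yT j : (3 <= j <= n)%N -> y j \in chain_tail 2.
  move=> Hj; rewrite yz; last by lia.
  rewrite -[z j](subrK (b 2%N ^+ (j - 2) *: x (j - 1)%N)) memvD //.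
    have /subvP tj : (chain_tail j <= chain_tail 2)%VS.
      by apply: chain_tail_sub; lia.
    by apply/tj/z_lead.
  by rewrite memvZ // mem_chain_tail //; lia.
(* [x_n, x_1] = 0, hence R_{x_1} and R_{x_n} commute. *)
have comm u : L (rn u) (y 2) = rn (L u (y 2)).
  rewrite !Ly2 /rn !brl; congr (_ - _).
  apply/eqP; rewrite -subr_eq0 -lbracket_leibniz br_n1 c0 b1.
  by rewrite !scale0r addr0 br0r.
have comm_iter k u : L (iter k rn u) (y 2) = iter k rn (L u (y 2)).
  by elim: k => //= k IH; rewrite comm IH.
have rn_n2 : rn (x (n - 2)%N) = b 2%N *: x (n - 1)%N.
  rewrite rn_x; last by lia.
  have -> : (n - (n - 2)).+1 = 3 by lia.
  rewrite big_nat1; congr (_ *: x _); lia.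
have rn_y1 : rn (y 1%N) = 0.
  rewrite y1 /rn !brl -!/(rn _) rn_xn rn_n2 scalerA -scalerDl.
  by rewrite mulNr divfK // subrr scale0r.
have iter_sum k (r : seq nat) (f : nat -> K) (v : nat -> V) :
    iter k rn (\sum_(m <- r) f m *: v m) = \sum_(m <- r) f m *: iter k rn (v m).
  elim: k => //= k ->; rewrite /rn br_suml; apply: eq_bigr => m _.
  by rewrite brl.
have y22 : L (y 2) (y 2) \in chain_tail 3.
  have -> : L (y 2) (y 2) = - (b 2%N)^-1 *: (rn (x 1%N) - b 2%N *: x 2)
      + ((b 2%N)^-1 ^+ 2 * b n.+1) *: x (n - 1)%N.
    rewrite Ly2 {1}y2 !brl br_n1 c0 b1 !scale0r addr0 scaler0 subr0.
    rewrite br_chain; last by lia.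
    rewrite y2 /rn !brl -!/(rn _) rn_xn !scalerBr !scalerA.
    rewrite !mulNr mulVf // scaleN1r opprK opprB addrC !scaleNr -!addrA.
    by rewrite [LHS]addrC -addrA expr2.
  have H1 : (1 <= 1 <= n - 2)%N by lia.
  by rewrite memvD ?memvZ ?rn_lead ?mem_chain_tail //; lia.
have [alpha alphaE] : exists al : nat -> K,
    L (y 2) (y 2) = \sum_(4 <= m < n.+1) al m *: z m.
  by apply: tail_z => //; lia.
(* [y_1, y_2] = - (b_{n+1} / b_2) x_{n-1}, and y_n = b_2^(n-2) x_{n-1}. *)
pose theta := - (b n.+1 / b 2%N) / b 2%N ^+ (n - 2).
have T2_y v : v \in chain_tail 2 -> v \in family_span n y.
  move=> /tail_z[|al ->]; first by lia.
  rewrite big_nat memv_suml // => m Hm; rewrite memvZ // -yz; last by lia.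
  by apply: mem_family_span; lia.
have xn_y : x n \in family_span n y.
  have -> : x n = y 1%N - w by rewrite y1 addrK.
  rewrite memvB ?mem_family_span //; first by lia.
  by apply/T2_y; rewrite memvZ // mem_chain_tail //; lia.
exists theta, alpha; apply: (has_mtableI (x := y)) => //.
- apply: (family_span_full spanx) => k Hk; have [->//|kn] := eqVneq k n.
  have [->|k1] := eqVneq k 1%N; last by apply/T2_y/mem_chain_tail; lia.
  have -> : x 1%N = y 2 + (b 2%N)^-1 *: x n by rewrite y2 subrK.
  by rewrite memvD ?memvZ ?mem_family_span //; lia.
- exact: local_F1.
move=> i j Hi Hj; rewrite /F1_mtable.
have [->|j1] := eqVneq j 1%N.
  rewrite Ly1; have [->|i1] := eqVneq i 1%N; first by rewrite rn_y1.
  rewrite (yz i) -?zS; try lia.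
  have [->|ni] := eqVneq i n.
    have -> : (2 <= n <= n - 1)%N = false by lia.
    by rewrite z_out ?andbF.
  have -> /= : (2 <= i <= n - 1)%N by lia.
  by rewrite yz //; lia.
have [->|j2] := eqVneq j 2; last first.
  by rewrite andbF /= L_tail // yT //; lia.
have [->|i1] := eqVneq i 1%N.
  rewrite /= Ly2 rn_y1 scaler0 subr0 y1 !brl br_n1 c0 b1 !scale0r !add0r.
  rewrite br_chain; last by lia.
  have -> : (n - 2).+1 = (n - 1)%N by lia.
  by rewrite yz ?z_n ?scalerA ?divfK ?expf_neq0 //; lia.
rewrite /= (yz i) /z; last by lia.
rewrite comm_iter -y2 alphaE iter_sum.
have iz m : (2 <= m)%N -> iter (i - 2) rn (z m) = z (i + m - 2)%N.
  by move=> Hm; rewrite /z -iterD; congr (iter _ _ _); lia.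
have [Hin|Hin] := leqP i (n - 2); last first.
  rewrite andbF big_nat big1 // => m Hm.
  by rewrite iz ?z_out ?scaler0 //; lia.
have -> /= : (2 <= i)%N by lia.
have [l1 l2] : (4 <= (n + 2 - i).+1)%N /\ ((n + 2 - i).+1 <= n.+1)%N by lia.
rewrite (@big_cat_nat _ _ _ _ _ _ _ _ l1 l2) /= [X in _ + X]big_nat.
rewrite [X in _ + X]big1 ?addr0 => [|m Hm]; last first.
  by rewrite iz ?z_out ?scaler0 //; lia.
by apply: eq_big_nat => m Hm; rewrite iz ?yz //; lia.
Qed.

(** * The classification *)

Lemma deformed_algebra_classification :
  [pchar K] =i pred0 -> (forall z : K, exists t, t ^+ 2 = z) ->
  (exists theta alpha, has_mtable n L (F1_mtable K n theta alpha)) \/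
  (exists beta gamma, has_mtable n L (F2_mtable K n beta gamma)) \/
  (exists a', has_mtable n L (mu_tilde_mtable K n a')) \/
  (exists a', has_mtable n L
     (oplus_abelian_mtable K n (mu_tilde_mtable K (n - 1) a'))) \/
  (exists2 a', \sum_(2 <= k < n) a' k = 1
     & has_mtable n L (nu1_mtable K n a')) \/
  has_mtable n L (nu2_mtable K n) \/
  (exists2 b', first_nonzero_eq1 K n b' & has_mtable n L (nu3_mtable K n b')) \/
  has_mtable n L (nu4_mtable K n) \/
  (exists a', has_mtable n L (nu5_mtable K n a')).
Proof.
move=> K0 sqrtK; have [co coE] := dual_family dimV spanx.
have [/allP b0|bn0] := boolP (all (fun k => b k == 0) (iota 1 n.+2)).
  case: right_n_eq0_cases => [k Hk|H|H|H]; [|tauto..].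
  by apply/eqP/b0; rewrite mem_iota; lia.
have nz : ~ (forall k, (1 <= k <= n.+2)%N -> b k = 0).
  move=> b0; case/negP: bn0; apply/allP => k; rewrite mem_iota => Hk.
  by rewrite b0 //; lia.
have an := a_n_eq0 coE nz; have bn := b_n_eq coE nz.
have bn2 := b_n2_eq0 coE nz.
have n1 : (n - 1)%:R != 0 :> K by move/pcharf0P: K0 => ->; lia.
have [b1|b1] := eqVneq (b 1%N) 0; last first.
  have [c0 a0 b0] := coefs_b1_neq0 coE nz K0 b1.
  by have H := nu2_normal_form n1 b1 c0 a0 b0 bn2; tauto.
have [c0|c0] := eqVneq c 0.
  have [bn' a0] := coefs_b1_c_eq0 coE nz b1 c0.
  have [b2|b2] := eqVneq (b 2%N) 0.
    by have H := F2_normal_form c0 a0 b1 b2 bn' bn2; tauto.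
  by have H := F1_normal_form c0 a0 b1 bn' bn2 b2; tauto.
have [bt|bt] := eqVneq (b (n - 1)%N) 0; last first.
  have [at_c a0 b0 bn1] := coefs_b_top_neq0 coE nz b1 c0 bt.
  by have H := nu3_normal_form c0 bt b1 bn an at_c a0 b0 bn1 bn2; tauto.
have [b0 a0] := coefs_b_top_eq0 coE nz b1 c0 bt.
have b0' k : (1 <= k <= n - 1)%N -> b k = 0.
  by move=> Hk; have [->//|k1] := eqVneq k 1%N; rewrite b0 //; lia.
have [bn1|bn1] := eqVneq (b n.+1) 0; last first.
  have [at_c a0'] := a0 bn1.
  by have H := nu4_normal_form sqrtK c0 bn1 bn an at_c a0' b0' bn2; tauto.
suff H : exists a', has_mtable n L (nu5_mtable K n a') by tauto.
apply: nu5_normal_form => // k Hk kn.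
have [->//|kn1] := eqVneq k n.+1; have [->//|kn2] := eqVneq k n.+2.
by rewrite b0' //; lia.
Qed.

End DeformedAlgebra.

Theorem proposition3p17 (R : realType) (n : nat) (hn : (4 <= n)%N)
    (phi : 'rV[R[i]]_n -> 'rV[R[i]]_n -> 'rV[R[i]]_n)
    (phiW : in_W R[i] n phi)
    (phiP : linear_integrable_deformation (Fn2 R[i] n) phi)
    (L := deformation phiP) :
  (exists (theta : R[i]) (alpha : nat -> R[i]),
     has_mtable n L (F1_mtable R[i] n theta alpha)) \/
  (exists (beta : nat -> R[i]) (gamma : R[i]),
     has_mtable n L (F2_mtable R[i] n beta gamma)) \/
  (exists a : nat -> R[i], has_mtable n L (mu_tilde_mtable R[i] n a)) \/
  (exists a : nat -> R[i],
     has_mtable n L (oplus_abelian_mtable R[i] n (mu_tilde_mtable R[i] (n - 1) a))) \/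
  (exists2 a : nat -> R[i], \sum_(2 <= k < n) a k = 1
     & has_mtable n L (nu1_mtable R[i] n a)) \/
  has_mtable n L (nu2_mtable R[i] n) \/
  (exists2 b : nat -> R[i], first_nonzero_eq1 R[i] n b
     & has_mtable n L (nu3_mtable R[i] n b)) \/
  has_mtable n L (nu4_mtable R[i] n) \/
  (exists a : nat -> R[i], has_mtable n L (nu5_mtable R[i] n a)).
Proof.
have [a [b [c tab]]] := deformation_table hn phiP phiW.
apply: (deformed_algebra_classification hn (std_basis_span R[i] n) tab).
- by rewrite dimvf /dim /= mul1n.
- exact: pchar_num.
by move=> z; exists (sqrtC z); rewrite sqrtCK.
Qed.
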